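(* Let $u_l,u_r\in\mathbb{R}$ and $\rho_l,\rho_r>0$ with $u_l>u_r$. For all sufficiently small $\epsilon>0$ let $(u^\epsilon,\rho^\epsilon)$ be the two-shock solution (described in the context) of the Riemann problem $$u_t+\Big(\frac{u^2}{2}+\epsilon p(\rho)\Big)_x=0,\quad \rho_t+(\rho u)_x=0,\quad (u,\rho)(x,0)=\begin{cases}(u_l,\rho_l), & x<0,\\ (u_r,\rho_r), & x>0.\end{cases}$$ Then, as $\epsilon\to0$, $u^\epsilon\to u$ and $\rho^\epsilon\to\rho$ in the sense of distributions on $\mathbb{R}\times(0,\infty)$, where $$u(x,t)=\begin{cases}u_l, & x<\frac{u_l+u_r}{2}t,\\ \frac{u_l+u_r}{2}, & x=\frac{u_l+u_r}{2}t,\\ u_r, & x>\frac{u_l+u_r}{2}t,\end{cases}$$ and $\rho$ equals $\rho_l$ for $x<\frac{u_l+u_r}{2}t$, equals $\rho_r$ for $x>\frac{u_l+u_r}{2}t$, and carries on the line $x=\frac{u_l+u_r}{2}t$ the weighted delta distribution $(u_l-u_r)\frac{\rho_l+\rho_r}{2}\,t\,\delta_{x=\frac{u_l+u_r}{2}t}$; that is, $$\rho=\rho_l\,\chi_{\{x<\frac{u_l+u_r}{2}t\}}+\rho_r\,\chi_{\{x>\frac{u_l+u_r}{2}t\}}+(u_l-u_r)\frac{\rho_l+\rho_r}{2}\,t\,\delta_{x=\frac{u_l+u_r}{2}t}.$$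
   Context: Here $p(\rho)=\int_0^\rho \frac{q'(\xi)}{\xi}\,d\xi$ with $q(\rho)=\int_0^\rho \xi^2 e^{\xi}\,d\xi$, i.e. $p(\rho)=\int_0^\rho \xi e^{\xi}\,d\xi$. States are pairs $(u,\rho)$ with $\rho>0$. The eigenvalues of the system are $\lambda_1(u,\rho)=u-\sqrt{\epsilon p'(\rho)\rho}$ and $\lambda_2(u,\rho)=u+\sqrt{\epsilon p'(\rho)\rho}$. A left state $(\bar u,\bar\rho)$ is connected to a different right state $(u,\rho)$ by a shock of speed $s$ if $s(u-\bar u)=(\frac{u^2}{2}+\epsilon p(\rho))-(\frac{\bar u^2}{2}+\epsilon p(\bar\rho))$ and $s(\rho-\bar\rho)=\rho u-\bar\rho\bar u$. It is an admissible 1-shock if $s<\lambda_1(\bar u,\bar\rho)$ and $\lambda_1(u,\rho)<s<\lambda_2(u,\rho)$; it is an admissible 2-shock if $s>\lambda_2(u,\rho)$ and $\lambda_1(\bar u,\bar\rho)<s<\lambda_2(\bar u,\bar\rho)$. When $u_l>u_r$, for all sufficiently small $\epsilon>0$ there is a unique state $(u^*_\epsilon,\rho^*_\epsilon)$ such that $(u_l,\rho_l)$ is connected to $(u^*_\epsilon,\rho^*_\epsilon)$ by an admissible 1-shock and $(u^*_\epsilon,\rho^*_\epsilon)$ is connected to $(u_r,\rho_r)$ by an admissible 2-shock. The two-shock solution is $$(u^\epsilon,\rho^\epsilon)(x,t)=\begin{cases}(u_l,\rho_l), & x<s_1t,\\ (u^*_\epsilon,\rho^*_\epsilon), & s_1t<x<s_2t,\\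 (u_r,\rho_r), & x>s_2t,\end{cases}$$ with $s_1=\frac{u^*_\epsilon+u_l}{2}+\frac{\epsilon(p(\rho^*_\epsilon)-p(\rho_l))}{u^*_\epsilon-u_l}$ and $s_2=\frac{u^*_\epsilon+u_r}{2}+\frac{\epsilon(p(\rho^*_\epsilon)-p(\rho_r))}{u^*_\epsilon-u_r}$ the speeds of the two shocks. For a smooth curve $x=c(t)$, the weighted delta distribution $d(t)\delta_{x=c(t)}$ is defined by $\langle d(t)\delta_{x=c(t)},\varphi\rangle=\int_0^\infty d(t)\varphi(c(t),t)\,dt$ for all $\varphi\in C_c^\infty(\mathbb{R}\times(0,\infty))$. *)

(* Defs.v *)
From HB Require Import structures.
From mathcomp Require Import all_boot all_order all_algebra.
From mathcomp Require Import all_classical all_reals all_analysis.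
Set Implicit Arguments.
Unset Strict Implicit.
Unset Printing Implicit Defensive.
Import Order.TTheory GRing.Theory Num.Theory.
Import numFieldNormedType.Exports.
Local Open Scope classical_set_scope.
Local Open Scope ring_scope.

(* A state (u, rho) is a pair w with w.1 = u and w.2 = rho > 0. A point (x, t) *)
(* of the plane is a pair z with z.1 = x and z.2 = t.                          *)

Definition pressure (R : realType) (rho : R) : R :=
  Rintegral (@lebesgue_measure R) `[0, rho] (fun xi => xi * expR xi).

Definition lambda1 (R : realType) (eps : R) (w : R * R) : R :=
  w.1 - Num.sqrt (eps * derive1 (@pressure R) w.2 * w.2).

Definition lambda2 (R : realType) (eps : R) (w : R * R) : R :=
  w.1 + Num.sqrt (eps * derive1 (@pressure R) w.2 * w.2).

Definition is_shock (R : realType) (eps : R) (wl wr : R * R) (s : R) : Prop :=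
  [/\ 0 < wl.2, 0 < wr.2, wl <> wr,
      s * (wr.1 - wl.1) = (wr.1 ^+ 2 / 2 + eps * pressure wr.2)
                          - (wl.1 ^+ 2 / 2 + eps * pressure wl.2)
    & s * (wr.2 - wl.2) = wr.2 * wr.1 - wl.2 * wl.1].

Definition admissible_1shock (R : realType) (eps : R) (wl wr : R * R) : Prop :=
  exists s : R, [/\ is_shock eps wl wr s, s < lambda1 eps wl,
                    lambda1 eps wr < s & s < lambda2 eps wr].

Definition admissible_2shock (R : realType) (eps : R) (wl wr : R * R) : Prop :=
  exists s : R, [/\ is_shock eps wl wr s, lambda2 eps wr < s,
                    lambda1 eps wl < s & s < lambda2 eps wl].

Definition intermediate_state (R : realType) (eps : R) (wl wr w : R * R) : Prop :=
  admissible_1shock eps wl w /\ admissible_2shock eps w wr.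

(* For the first shock w0 is the left state, for the second one w0 is the      *)
(* right state; w is the intermediate state in both cases.                     *)
Definition shock_speed (R : realType) (eps : R) (w w0 : R * R) : R :=
  (w.1 + w0.1) / 2 + eps * (pressure w.2 - pressure w0.2) / (w.1 - w0.1).

(* The values on the null set of the two shock lines are arbitrary.            *)
Definition two_shock (R : realType) (eps : R) (wl w wr : R * R) (z : R * R) :
    R * R :=
  if z.1 < shock_speed eps w wl * z.2 then wl
  else if z.1 < shock_speed eps w wr * z.2 then w
  else wr.

Fixpoint Ck (R : realType) (k : nat) (f : R * R -> R) : Prop :=
  if k is k'.+1 then
    [/\ continuous f,
        (forall z, derivable f z (1, 0)) /\ (forall z, derivable f z (0, 1)),
        Ck k' ('D_(1, 0) f)
      & Ck k' ('D_(0, 1) f)]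
  else continuous f.

(* C_c^oo(R x (0, +oo)), every test function being extended by 0 to the plane. *)
Definition test_function (R : realType) (phi : R * R -> R) : Prop :=
  [/\ forall k, Ck k phi,
      compact (closure [set z | phi z != 0])
    & closure [set z | phi z != 0] `<=` [set z | 0 < z.2]].

(* Distributions are represented by their action on test functions; on other   *)
(* functions the values below are irrelevant.                                  *)
Definition regular_distr (R : realType) (f phi : R * R -> R) : R :=
  Rintegral (@lebesgue_measure R \x @lebesgue_measure R)%E
    [set z | 0 < z.2] (fun z => f z * phi z).

(* d(t) delta_{x = c(t)} *)
Definition line_delta (R : realType) (d c : R -> R) (phi : R * R -> R) : R :=
  Rintegral (@lebesgue_measure R) `]0, +oo[ (fun t => d t * phi (c t, t)).

Definition distr_cvg0 (R : realType) (T : R -> (R * R -> R) -> R)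
    (L : (R * R -> R) -> R) : Prop :=
  forall phi, test_function phi -> T eps phi @[eps --> (0 : R)^'+] --> L phi.

Definition limit_u (R : realType) (ul ur : R) (z : R * R) : R :=
  if z.1 < (ul + ur) / 2 * z.2 then ul
  else if z.1 == (ul + ur) / 2 * z.2 then (ul + ur) / 2
  else ur.

Definition limit_rho (R : realType) (ul ur rhol rhor : R) (phi : R * R -> R) : R :=
  regular_distr
    (fun z => rhol * \1_[set y : R * R | y.1 < (ul + ur) / 2 * y.2] z
              + rhor * \1_[set y : R * R | y.1 > (ul + ur) / 2 * y.2] z) phi
  + line_delta (fun t => (ul - ur) * ((rhol + rhor) / 2) * t)
      (fun t => (ul + ur) / 2 * t) phi.

(* Main.v *)
Require Import Defs.
From HB Require Import structures.
From mathcomp Require Import all_boot all_order all_algebra.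
From mathcomp Require Import all_classical all_reals all_analysis.
From mathcomp Require Import measurable_realfun ring lra.
Import Order.TTheory GRing.Theory Num.Theory.
Import numFieldNormedType.Exports.
Local Open Scope classical_set_scope.
Local Open Scope ring_scope.

(** Across a shock the two Rankine-Hugoniot relations determine the speed and
    force (u - v)^2 (r + a) = 2 eps (r - a) (p(r) - p(a)), where (v, a) and
    (u, r) are the two states.  Since p is increasing with p'(x) = x e^x, the
    mean value bounds on p show that Lax's inequalities select exactly the
    branch on which the density grows towards the intermediate state
    ([admissible_1shockP]; 2-shocks are the mirror images of 1-shocks).  Hence
    the intermediate density r is a root of
      sqrt eps * (H(rhol, r) + H(rhor, r)) = ul - ur,  r > max(rhol, rhor),
    with H = [shock_strength], increasing, continuous and unbounded in r: the
    root exists and is unique for small eps, and it tends to infinity as eps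
    tends to 0.  The two strengths are then equivalent to sqrt(2 p(r)), so
    each shock takes half of the velocity jump: u tends to
    sigma = (ul + ur) / 2, and so do both speeds.  Conservation of mass gives
    r (s2 - s1) = s2 rhor - s1 rhol - rhor ur + rhol ul, which tends to
    (ul - ur) (rhol + rhor) / 2: the narrow wedge between the shocks retains a
    finite mass per unit time.

    On the distribution side, put J(s) = the integral of phi over the part of
    the half-plane t > 0 to the left of x = s t ([left_pairing]).  A piecewise
    constant function pairs with phi as an affine combination of J(s1) and
    J(s2) ([step_integral]), so everything reduces to the strict
    differentiability of J at sigma,
      J(s2) - J(s1) = (s2 - s1) (B + o(1)),  B = int_0^oo t phi(sigma t, t) dt,
    which follows from Fubini's theorem on the wedge and from the uniform
    continuity of phi ([strict_derivative_left_pairing]).  In particular J is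
    continuous at sigma, which settles the velocity, while
    r (J(s2) - J(s1)) = r (s2 - s1) (B + o(1)) produces the delta
    distribution in the density. *)

(** * The pressure law *)

Section Pressure.
Context {R : realType}.
Implicit Types a b r : R.

Let is_derive_closed_form (x : R) :
  is_derive x 1 (fun y : R => (y - 1) * expR y + 1) (x * expR x).
Proof.
apply: is_derive_eq.
by rewrite /GRing.scale/= ; ring.
Qed.

Let continuous_closed_form : continuous (fun y : R => (y - 1) * expR y + 1).
Proof.
move=> x; apply: differentiable_continuous; apply/derivable1_diffP.
by have [] := is_derive_closed_form x.
Qed.

(** On negative arguments the interval of integration is empty and the closed
    form fails, hence the sign condition. *)
Lemma pressureE r : 0 <= r -> pressure r = (r - 1) * expR r + 1.
Proof.
rewrite le_eqVlt => /predU1P[<-|r0].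
  by rewrite /pressure set_itv1 Rintegral_set1 expR0; ring.
rewrite /pressure /Rintegral.
rewrite (@continuous_FTC2 _ (fun x => x * expR x)
  (fun y => (y - 1) * expR y + 1)) //=.
- by rewrite expR0; ring.
- apply: continuous_subspaceT => x.
  by apply: cvgM; [exact: cvg_id|exact: continuous_expR].
- split.
  + by move=> x _; have [] := is_derive_closed_form x.
  + by apply/cvg_at_right_filter/continuous_closed_form.
  + by apply/cvg_at_left_filter/continuous_closed_form.
- move=> x _; rewrite derive1E; apply: derive_val; exact: is_derive_closed_form.
Qed.

Lemma derive1_pressure r : 0 < r -> derive1 (@pressure R) r = r * expR r.
Proof.
move=> r0; rewrite derive1E.
rewrite (@near_eq_derive _ _ _ _ (fun y : R => (y - 1) * expR y + 1)).
  by apply: derive_val; exact: is_derive_closed_form.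
near=> y; apply: pressureE; apply: ltW.
near: y; exact: lt_nbhsr.
Unshelve. all: by end_near. Qed.

(** The mean value theorem for p, whose derivative x e^x is increasing: both
    of Lax's inequalities and the monotonicity of p come from these bounds. *)
Lemma pressure_slope a b : 0 <= a -> a < b ->
  a * expR a * (b - a) < pressure b - pressure a < b * expR b * (b - a).
Proof.
move=> a0 ab; rewrite !pressureE ?(le_trans a0 (ltW ab))//.
have [] := @MVT R _ _ a b ab (fun x _ => is_derive_closed_form x).
  exact: continuous_subspaceT.
move=> c /[!in_itv]/= /andP[ac cb] ->.
have c0 : 0 < c by rewrite (le_lt_trans a0).
rewrite !ltr_pM2r ?subr_gt0//; apply/andP; split.
  by apply: ltr_pM => //; rewrite ?expR_ge0 ?ltr_expR.
by apply: ltr_pM; rewrite ?expR_ge0 ?ltr_expR// ltW.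
Qed.

Lemma pressure_lt a b : 0 <= a -> a < b -> pressure a < pressure b.
Proof.
move=> a0 ab; rewrite -subr_gt0; have /andP[+ _] := pressure_slope a b a0 ab.
by apply: le_lt_trans; rewrite !mulr_ge0// ?expR_ge0// subr_ge0 ltW.
Qed.

Lemma pressure_ge0 a : 0 <= a -> 0 <= pressure a.
Proof.
have p0 : @pressure R 0 = 0 by rewrite pressureE// expR0; ring.
rewrite le_eqVlt => /predU1P[<-|a0]; first by rewrite p0.
by rewrite -p0 ltW// pressure_lt.
Qed.

Lemma continuous_pressure r : 0 < r -> {for r, continuous (@pressure R)}.
Proof.
move=> r0; rewrite /prop_for /continuous_at pressureE ?(ltW r0)//.
apply: cvg_trans (continuous_closed_form r).
apply: near_eq_cvg; near=> y; apply/esym/pressureE/ltW.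
near: y; exact: lt_nbhsr.
Unshelve. all: by end_near. Qed.

Lemma cvg_pressure_y : @pressure R x @[x --> +oo] --> +oo.
Proof.
apply: (@ger_cvgy _ _ _ _ (fun x : R => x - 1)).
  near=> x; rewrite pressureE; last by near: x; exact: nbhs_pinfty_ge.
  apply: (@le_trans _ _ ((x - 1) * expR x)); last by rewrite lerDl.
  have x1 : 1 <= x by near: x; exact: nbhs_pinfty_ge.
  rewrite -[leLHS]mulr1; apply: ler_wpM2l; first by rewrite subr_ge0.
  by rewrite -expR0 ler_expR (le_trans _ x1).
apply/cvgryPge => A; near=> x; rewrite lerBrDr.
by near: x; apply: nbhs_pinfty_ge; exact: num_real.
Unshelve. all: by end_near. Qed.

End Pressure.

(** * Admissible shocks *)

Section ShockCurves.
Context {R : realType}.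
Implicit Types a r u v s eps : R.

(** The velocity jump, divided by sqrt eps, of the shock joining the densities
    a and r: solving the relation of [hugoniot] for the velocity jump. *)
Definition shock_strength a r : R :=
  Num.sqrt (2 * (r - a) * (pressure r - pressure a) / (r + a)).

Lemma shock_strength_arg_gt0 a r : 0 < a -> a < r ->
  0 < 2 * (r - a) * (pressure r - pressure a) / (r + a).
Proof.
move=> a0 ar; have pp := pressure_lt a r (ltW a0) ar.
by rewrite divr_gt0 ?mulr_gt0 ?subr_gt0// addr_gt0// (lt_trans a0).
Qed.

Lemma shock_strength_gt0 a r : 0 < a -> a < r -> 0 < shock_strength a r.
Proof. by move=> a0 ar; rewrite sqrtr_gt0 shock_strength_arg_gt0. Qed.

Lemma sqr_shock_strength a r : 0 < a -> a < r ->
  shock_strength a r ^+ 2 = 2 * (r - a) * (pressure r - pressure a) / (r + a).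
Proof.
by move=> a0 ar; rewrite sqr_sqrtr// ltW// shock_strength_arg_gt0.
Qed.

(** The square of the inequality s < lambda1 at the state (v, a), after clearing
    denominators.  By [pressure_slope] it reduces to a (r + a) < 2 r^2. *)
Lemma lax_left a r : 0 < a -> a < r ->
  a ^+ 2 * expR a * (r - a) ^+ 2 < (r * shock_strength a r) ^+ 2.
Proof.
move=> a0 ar; have r0 : 0 < r by rewrite (lt_trans a0).
have ra0 : 0 < r - a by rewrite subr_gt0.
have rpa : 0 < r + a by rewrite addr_gt0.
have /andP[h _] := pressure_slope a r (ltW a0) ar.
rewrite exprMn sqr_shock_strength// [ltRHS]mulrA ltr_pdivlMr//.
move: (expR a) (expR_gt0 a) (pressure r - pressure a) h => E E0 P h.
have h1 : 2 * r ^+ 2 * (r - a) * (a * E * (r - a)) < 2 * r ^+ 2 * (r - a) * P.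
  by rewrite ltr_pM2l// !mulr_gt0// exprn_gt0.
have h2 : 0 < a * E * (r - a) ^+ 2 * ((r - a) * (2 * r + a)).
  by rewrite !mulr_gt0 ?exprn_gt0// addr_gt0// mulr_gt0.
rewrite -subr_gt0 in h1; rewrite -subr_gt0.
have := addr_gt0 h1 h2.
by congr (0 < _); ring.
Qed.

(** The square of the inequality lambda1 < s at the state (u, r); it reduces to
    2 a^2 < r (r + a). *)
Lemma lax_right a r : 0 < a -> a < r ->
  (a * shock_strength a r) ^+ 2 < r ^+ 2 * expR r * (r - a) ^+ 2.
Proof.
move=> a0 ar; have r0 : 0 < r by rewrite (lt_trans a0).
have ra0 : 0 < r - a by rewrite subr_gt0.
have rpa : 0 < r + a by rewrite addr_gt0.
have /andP[_ h] := pressure_slope a r (ltW a0) ar.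
rewrite exprMn sqr_shock_strength// [ltLHS]mulrA ltr_pdivrMr//.
move: (expR r) (expR_gt0 r) (pressure r - pressure a) h => E E0 P h.
have h1 : 2 * a ^+ 2 * (r - a) * P < 2 * a ^+ 2 * (r - a) * (r * E * (r - a)).
  by rewrite ltr_pM2l// !mulr_gt0// exprn_gt0.
have h2 : 0 < r * E * (r - a) ^+ 2 * ((r - a) * (r + 2 * a)).
  by rewrite !mulr_gt0 ?exprn_gt0// addr_gt0// mulr_gt0.
rewrite -subr_gt0 in h1; rewrite -subr_gt0.
have := addr_gt0 h1 h2.
by congr (0 < _); ring.
Qed.

(** Eliminating the speed from the two Rankine-Hugoniot relations. *)
Lemma hugoniot eps u v a r s :
  s * (u - v) =
    (u ^+ 2 / 2 + eps * pressure r) - (v ^+ 2 / 2 + eps * pressure a) ->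
  s * (r - a) = r * u - a * v ->
  (u - v) ^+ 2 * (r + a) = eps * (2 * (r - a) * (pressure r - pressure a)).
Proof.
move=> e1 e2.
have e3 : s * (r - a) * (u - v) = (r * u - a * v) * (u - v) by rewrite e2.
have e4 : s * (u - v) * (r - a) = ((u ^+ 2 / 2 + eps * pressure r) -
  (v ^+ 2 / 2 + eps * pressure a)) * (r - a) by rewrite e1.
move: (pressure r) (pressure a) e4 e3 => P Q e4 e3.
have : (r * u - a * v) * (u - v) = ((u ^+ 2 / 2 + eps * P) -
  (v ^+ 2 / 2 + eps * Q)) * (r - a) by rewrite -e3 -e4; ring.
lra.
Qed.

(** Conversely, the speed that conserves mass also conserves velocity once the
    states lie on the Hugoniot curve. *)
Lemma hugoniot_shock eps v a r : 0 < eps -> 0 < a -> a < r ->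
  let u := v - Num.sqrt eps * shock_strength a r in
  is_shock eps (v, a) (u, r) (v + r * (u - v) / (r - a)).
Proof.
move=> e0 a0 ar u; have r0 : 0 < r by rewrite (lt_trans a0).
have ra0 : r - a != 0 by rewrite subr_eq0 gt_eqF.
have rpa : r + a != 0 by rewrite gt_eqF// addr_gt0.
split=> //=.
- by move=> [_ ra]; rewrite ra ltxx in ar.
- have : (u - v) ^+ 2 * (r + a) = eps * (2 * (r - a) * (pressure r - pressure a)).
    rewrite /u addrAC subrr add0r sqrrN exprMn sqr_sqrtr ?(ltW e0)//.
    by rewrite sqr_shock_strength// -!mulrA mulVf// mulr1.
  move: (pressure r) (pressure a) => P Q h.
  apply: (mulIf ra0); rewrite mulrDl mulrDl.
  have -> : r * (u - v) / (r - a) * (u - v) * (r - a) = r * (u - v) ^+ 2.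
    by field.
  lra.
- by field.
Qed.

Lemma sound_sqr eps r : 0 < eps -> 0 < r ->
  eps * derive1 (@pressure R) r * r = (Num.sqrt eps * r * Num.sqrt (expR r)) ^+ 2.
Proof.
move=> e0 r0; rewrite derive1_pressure// !exprMn !sqr_sqrtr ?(ltW e0) ?expR_ge0//.
by ring.
Qed.

Lemma sound_speedE eps r : 0 < eps -> 0 < r ->
  Num.sqrt (eps * derive1 (@pressure R) r * r) =
  Num.sqrt eps * r * Num.sqrt (expR r).
Proof.
move=> e0 r0; rewrite sound_sqr// sqrtr_sqr ger0_norm//.
by rewrite !mulr_ge0// ltW.
Qed.

(** Lax's inequalities leave only the compressive half of the Hugoniot curve.
    For the direct sense the left inequality alone is contradictory when the
    density decreases: it would give a (r + a) < 2 r^2 with r < a. *)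
Lemma admissible_1shockP eps v a u r : 0 < eps -> 0 < a ->
  admissible_1shock eps (v, a) (u, r) <->
  a < r /\ u = v - Num.sqrt eps * shock_strength a r.
Proof.
move=> e0 a0; have se0 : 0 < Num.sqrt eps by rewrite sqrtr_gt0.
have sea : Num.sqrt (expR a) ^+ 2 = expR a by rewrite sqr_sqrtr// expR_ge0.
have ser r' : Num.sqrt (expR r') ^+ 2 = expR r' by rewrite sqr_sqrtr// expR_ge0.
split.
  move=> [s [[/= _ r0 ne e1 e2]]]; rewrite /lambda1 /lambda2/= !sound_speedE//.
  move=> slt sgt _.
  have e3 : (s - v) * (r - a) = r * (u - v) by rewrite mulrBl e2; ring.
  have H := hugoniot eps u v a r s e1 e2.
  have vs0 : Num.sqrt eps * a * Num.sqrt (expR a) < v - s by lra.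
  have c0 : 0 < Num.sqrt eps * a * Num.sqrt (expR a).
    by rewrite !mulr_gt0// sqrtr_gt0 expR_gt0.
  have [ra|ar|ra] := ltgtP r a; last first.
  (* equal densities force equal velocities, hence equal states *)
  - case: ne; congr pair; last by rewrite ra.
    move: H; rewrite ra subrr mulr0 mul0r mulr0 => /eqP.
    by rewrite mulf_eq0 (gt_eqF (addr_gt0 a0 a0)) orbF sqrf_eq0 subr_eq0 => /eqP.
  - split=> //.
    have uv : u < v.
      have : r * (u - v) < 0.
        by rewrite -e3 nmulr_rlt0 ?subr_gt0// subr_lt0; lra.
      by rewrite pmulr_rlt0// subr_lt0.
    have : (v - u) ^+ 2 = (Num.sqrt eps * shock_strength a r) ^+ 2.
      rewrite exprMn sqr_sqrtr ?(ltW e0)// sqr_shock_strength// [RHS]mulrA -H.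
      by rewrite mulfK ?gt_eqF ?addr_gt0//; ring.
    move/eqP; rewrite eqrXn2// ?mulr_ge0 ?subr_ge0 ?(ltW uv)//; last first.
      by rewrite ltW// shock_strength_gt0.
    by move=> /eqP <-; ring.
  (* the squared left inequality contradicts the slope bound on [r, a] *)
  - exfalso.
    have h1 : (Num.sqrt eps * a * Num.sqrt (expR a)) ^+ 2 < (v - s) ^+ 2.
      by rewrite ltrXn2r// ?(ltW c0)// (lt_trans c0).
    have h2 : (v - s) ^+ 2 * (r - a) ^+ 2 = r ^+ 2 * (u - v) ^+ 2.
      by rewrite -!exprMn -e3; ring.
    have /andP[_ h4] := pressure_slope r a (ltW r0) ra.
    have d0 : 0 < a - r by rewrite subr_gt0.
    move: h1; rewrite !exprMn sea sqr_sqrtr ?(ltW e0)// => h1.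
    have h5 : eps * a ^+ 2 * expR a * ((r - a) ^+ 2 * (r + a)) <
        (v - s) ^+ 2 * ((r - a) ^+ 2 * (r + a)).
      rewrite ltr_pM2r// mulr_gt0 ?addr_gt0//.
      by rewrite -sqrrN opprB exprn_gt0.
    move: h5; rewrite [ltRHS]mulrA h2 -[ltRHS]mulrA H.
    move: (pressure r) (pressure a) (expR a) (expR_gt0 a) h4 => P Q E E0 h4.
    apply/negP; rewrite -leNgt.
    have h6 : r ^+ 2 * eps * 2 * (a - r) * (Q - P) <=
              r ^+ 2 * eps * 2 * (a - r) * (a * E * (a - r)).
      by rewrite ler_wpM2l ?(ltW h4)// !mulr_ge0// ltW.
    have h7 : 0 <= eps * a * E * (a - r) ^+ 2 * ((a - r) * (a + 2 * r)).
      by rewrite ltW// !mulr_gt0 ?exprn_gt0// addr_gt0// mulr_gt0.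
    rewrite -subr_ge0 in h6; rewrite -subr_ge0.
    have := addr_ge0 h6 h7.
    by congr (0 <= _); ring.
move=> [ar ->]; have r0 : 0 < r by rewrite (lt_trans a0).
have H0 := shock_strength_gt0 a r a0 ar.
have ra0 : 0 < r - a by rewrite subr_gt0.
(* q is the ratio of the velocity jump over sqrt eps to the density jump; with
   it the shock speed is both v - sqrt eps * (r q) and u - sqrt eps * (a q). *)
set q := shock_strength a r / (r - a).
have q0 : 0 < q by rewrite divr_gt0.
have Hq : shock_strength a r = q * (r - a) by rewrite /q divfK// gt_eqF.
move: q q0 Hq => q q0 Hq.
have h1 : a * Num.sqrt (expR a) < r * q.
  rewrite -(@ltr_pXn2r _ 2)//
    ?nnegrE ?mulr_ge0 ?sqrtr_ge0 ?(ltW a0) ?(ltW r0) ?(ltW q0)//.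
  have := lax_left a r a0 ar.
  by rewrite Hq mulrA !exprMn sea ltr_pM2r// exprn_gt0.
have h2 : a * q < r * Num.sqrt (expR r).
  rewrite -(@ltr_pXn2r _ 2)//
    ?nnegrE ?mulr_ge0 ?sqrtr_ge0 ?(ltW a0) ?(ltW r0) ?(ltW q0)//.
  have := lax_right a r a0 ar.
  by rewrite Hq mulrA !exprMn ser ltr_pM2r// exprn_gt0.
rewrite /admissible_1shock.
exists (v + r * ((v - Num.sqrt eps * shock_strength a r) - v) / (r - a)).
split.
- exact: hugoniot_shock.
- rewrite /lambda1/= sound_speedE// Hq.
  have -> : r * (v - Num.sqrt eps * (q * (r - a)) - v) / (r - a) =
    - (Num.sqrt eps * (r * q)) by field; rewrite gt_eqF.
  by rewrite ltrD2l ltrN2 -mulrA ltr_pM2l.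
- rewrite /lambda1/= sound_speedE// Hq.
  have -> : v + r * (v - Num.sqrt eps * (q * (r - a)) - v) / (r - a) =
    v - Num.sqrt eps * (q * (r - a)) - (Num.sqrt eps * (a * q)).
    by field; rewrite gt_eqF.
  by rewrite ltrD2l ltrN2 -mulrA ltr_pM2l.
- rewrite /lambda2/= sound_speedE// Hq.
  have -> : v + r * (v - Num.sqrt eps * (q * (r - a)) - v) / (r - a) =
    v - Num.sqrt eps * (q * (r - a)) - (Num.sqrt eps * (a * q)).
    by field; rewrite gt_eqF.
  rewrite ltrD2l; apply: (@lt_trans _ _ 0); first by rewrite oppr_lt0 !mulr_gt0.
  by rewrite !mulr_gt0// sqrtr_gt0 expR_gt0.
Qed.

(** The reflection x -> -x changes the signs of velocities and speeds and
    exchanges the two sides of a shock as well as the two families. *)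
Lemma admissible_2shock_mirror eps u r v a :
  admissible_2shock eps (u, r) (v, a) <-> admissible_1shock eps (- v, a) (- u, r).
Proof.
rewrite /admissible_2shock /admissible_1shock /lambda1 /lambda2 /is_shock /=.
split=> -[s [[h1 h2 h3 h4 h5] h6 h7 h8]]; exists (- s); split; try lra.
- split=> //; last by lra.
    by move=> [/oppr_inj e1 e2]; apply: h3; rewrite e1 e2.
  by rewrite !sqrrN; lra.
- split=> //; last by lra.
    by move=> [e1 e2]; apply: h3; rewrite e1 e2.
  by move: h4; rewrite !sqrrN; lra.
Qed.

Lemma admissible_2shockP eps u r v a : 0 < eps -> 0 < a ->
  admissible_2shock eps (u, r) (v, a) <->
  a < r /\ u = v + Num.sqrt eps * shock_strength a r.
Proof.
move=> e0 a0; rewrite admissible_2shock_mirror admissible_1shockP//.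
by split=> -[ar e]; split=> //; [rewrite -(opprK u) e; ring|rewrite e; ring].
Qed.

End ShockCurves.

(** * The intermediate state *)

Section IntermediateState.
Context {R : realType}.
Implicit Types a r u v s eps : R.

Lemma intermediate_stateP eps ul ur rhol rhor (w : R * R) :
  0 < eps -> 0 < rhol -> 0 < rhor ->
  intermediate_state eps (ul, rhol) (ur, rhor) w <->
  [/\ rhol < w.2, rhor < w.2, w.1 = ul - Num.sqrt eps * shock_strength rhol w.2
    & w.1 = ur + Num.sqrt eps * shock_strength rhor w.2].
Proof.
case: w => u r e0 l0 r0; rewrite /intermediate_state.
rewrite admissible_1shockP// admissible_2shockP//=.
by split=> [[[? ?] [? ?]]|[? ? ? ?]].
Qed.

(** Both (r - a) / (r + a) and p(r) - p(a) increase with r. *)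
Lemma shock_strength_lt a r r' : 0 < a -> a <= r -> r < r' ->
  shock_strength a r < shock_strength a r'.
Proof.
move=> a0; rewrite le_eqVlt => /predU1P[<- rr|ar rr].
  rewrite {1}/shock_strength subrr mulr0 mul0r mul0r sqrtr0.
  exact: shock_strength_gt0.
have r0 : 0 < r by rewrite (lt_trans a0).
have ar' := lt_trans ar rr; have r'0 := lt_trans r0 rr.
rewrite ltr_sqrt ?shock_strength_arg_gt0//.
have -> : 2 * (r - a) * (pressure r - pressure a) / (r + a) =
  2 * ((r - a) / (r + a)) * (pressure r - pressure a).
  by field; rewrite gt_eqF// addr_gt0.
have -> : 2 * (r' - a) * (pressure r' - pressure a) / (r' + a) =
  2 * ((r' - a) / (r' + a)) * (pressure r' - pressure a).
  by field; rewrite gt_eqF// addr_gt0.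
have pr0 := pressure_lt a r (ltW a0) ar.
apply: ltr_pM; rewrite ?mulr_ge0 ?invr_ge0 ?subr_ge0 ?addr_ge0 ?(ltW _)//.
  rewrite ltr_pM2l// ltr_pdivrMr ?addr_gt0// mulrAC ltr_pdivlMr ?addr_gt0//.
  rewrite -subr_gt0.
  have -> : (r' - a) * (r + a) - (r - a) * (r' + a) = 2 * a * (r' - r) by ring.
  by rewrite !mulr_gt0// subr_gt0.
by rewrite ltrD2r pressure_lt// ltW.
Qed.

Lemma continuous_shock_strength a r : 0 < a -> 0 < r ->
  {for r, continuous (shock_strength a)}.
Proof.
move=> a0 r0; apply: continuous_comp; last exact: sqrt_continuous.
apply: cvgM; last first.
  apply: cvgV; first by rewrite gt_eqF// addr_gt0.
  by apply: cvgD; [exact: cvg_id|exact: cvg_cst].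
apply: cvgM.
  apply: cvgM; first exact: cvg_cst.
  by apply: cvgB; [exact: cvg_id|exact: cvg_cst].
by apply: cvgB; [exact: continuous_pressure|exact: cvg_cst].
Qed.

Lemma cvg_inv_addr_y a : (r + a)^-1 @[r --> +oo] --> (0 : R).
Proof.
apply/gtr0_cvgV0.
  near=> r; rewrite -ltrBlDr sub0r.
  by near: r; apply: nbhs_pinfty_gt; exact: num_real.
apply/cvgryPge => A; near=> r; rewrite -lerBlDr.
by near: r; apply: nbhs_pinfty_ge; exact: num_real.
Unshelve. all: by end_near. Qed.

Lemma cvg_inv_pressure_y : (pressure r)^-1 @[r --> +oo] --> (0 : R).
Proof.
apply/gtr0_cvgV0; last exact: cvg_pressure_y.
have /cvgryPgt/(_ 0) := @cvg_pressure_y R; exact.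
Qed.

(** H(a, r)^2 = 2 p(r) (1 - 2 a / (r + a)) (1 - p(a) / p(r)): to leading order
    the strength does not depend on a, so the two shocks become equally
    strong. *)
Lemma shock_strength_equiv a : 0 < a ->
  shock_strength a r / Num.sqrt (2 * pressure r) @[r --> +oo] --> (1 : R).
Proof.
move=> a0.
suff : Num.sqrt ((1 - 2 * a * (r + a)^-1) * (1 - pressure a * (pressure r)^-1))
    @[r --> +oo] --> Num.sqrt ((1 - 2 * a * 0) * (1 - pressure a * 0) : R).
  rewrite !mulr0 subr0 mulr1 sqrtr1; apply: cvg_trans.
  apply: near_eq_cvg; near=> r.
  have ar : a < r by near: r; apply: nbhs_pinfty_gt; exact: num_real.
  have r0 := lt_trans a0 ar.
  have p0 : 0 < pressure r.
    by rewrite (le_lt_trans (pressure_ge0 a (ltW a0)))// pressure_lt// ltW.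
  rewrite /shock_strength -sqrtrV ?mulr_ge0 ?ltW// -sqrtrM; last first.
    exact/ltW/shock_strength_arg_gt0.
  congr Num.sqrt; field.
  by rewrite !gt_eqF// addr_gt0.
apply: (@cvg_comp _ _ _ _ Num.sqrt); last exact: sqrt_continuous.
apply: cvgM.
  apply: cvgB; first exact: cvg_cst.
  by apply: cvgM; [exact: cvg_cst|exact: cvg_inv_addr_y].
apply: cvgB; first exact: cvg_cst.
by apply: cvgM; [exact: cvg_cst|exact: cvg_inv_pressure_y].
Unshelve. all: by end_near. Qed.

(** For r > 3 a the factor (r - a) / (r + a) exceeds 1/2, so that H^2 is at
    least p(r) - p(a). *)
Lemma cvg_shock_strength_y a : 0 < a -> shock_strength a r @[r --> +oo] --> +oo.
Proof.
move=> a0; apply/cvgryPge => A.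
near=> r.
have ar : 3 * a < r by near: r; apply: nbhs_pinfty_gt; exact: num_real.
have pr : pressure a + A ^+ 2 <= pressure r.
  near: r; have /cvgryPge := @cvg_pressure_y R; exact.
rewrite (le_trans (ler_norm A))// -sqrtr_sqr ler_wsqrtr//.
rewrite ler_pdivlMr; last by lra.
have h : 0 <= A ^+ 2 by rewrite sqr_ge0.
apply: (@le_trans _ _ (2 * (r - a) * A ^+ 2)); first by nra.
by apply: ler_wpM2l; lra.
Unshelve. all: by end_near. Qed.

Lemma near0_sqrt_mul_lt (C D : R) : 0 < D ->
  \forall eps \near 0^'+, Num.sqrt eps * C < D.
Proof.
move=> D0.
have : Num.sqrt eps * C @[eps --> (0 : R)] --> Num.sqrt 0 * C.
  by apply: cvgM; [exact: sqrt_continuous|exact: cvg_cst].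
rewrite sqrtr0 mul0r => /cvg_at_right_filter /cvgr_lt; exact.
Qed.

(** The sum of the two strengths increases continuously from its value at the
    larger of the two given densities to infinity, hence takes the value
    (ul - ur) / sqrt eps exactly once when eps is small. *)
Lemma near0_intermediate_state ul ur rhol rhor :
  0 < rhol -> 0 < rhor -> ur < ul ->
  \forall eps \near (0 : R)^'+,
    exists! w : R * R, intermediate_state eps (ul, rhol) (ur, rhor) w.
Proof.
move=> l0 r0 u0; pose S r := shock_strength rhol r + shock_strength rhor r.
pose m := Num.max rhol rhor.
have lm : rhol <= m by rewrite le_max lexx.
have rm : rhor <= m by rewrite le_max lexx orbT.
have m0 : 0 < m := lt_le_trans l0 lm.
have S_lt x y : m <= x -> x < y -> S x < S y.
  by move=> mx xy; rewrite ltrD// shock_strength_lt// (le_trans _ mx).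
near=> eps.
have e0 : 0 < eps by near: eps; exact: nbhs_right_gt.
have se0 : 0 < Num.sqrt eps by rewrite sqrtr_gt0.
have Sm : Num.sqrt eps * S m < ul - ur.
  by near: eps; apply: near0_sqrt_mul_lt; rewrite subr_gt0.
pose d := (ul - ur) / Num.sqrt eps.
have Smd : S m < d by rewrite ltr_pdivlMr// mulrC.
have [B mB SB] : exists2 B, m <= B & d <= S B.
  near +oo_R => B; exists B.
    by near: B; apply: nbhs_pinfty_ge; exact: num_real.
  rewrite -[leLHS]addr0 lerD//; near: B.
    by have /cvgryPge := cvg_shock_strength_y rhol l0; exact.
  by have /cvgryPge := cvg_shock_strength_y rhor r0; exact.
have cS : {within `[m, B], continuous S}.
  apply: continuous_in_subspaceT => x; rewrite inE/= in_itv/= => /andP[mx _].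
  have x0 := lt_le_trans m0 mx.
  by apply: cvgD; exact: continuous_shock_strength.
have [|c] := @IVT _ S m B d mB cS.
  by rewrite ge_min (ltW Smd) le_max SB orbT.
rewrite in_itv/= le_eqVlt => /andP[/predU1P[<- _ eSd|mc _ Sc]].
  by rewrite eSd ltxx in Smd.
exists (ul - Num.sqrt eps * shock_strength rhol c, c); split.
  apply/intermediate_stateP => //=; split=> //.
  - exact: le_lt_trans mc.
  - exact: le_lt_trans mc.
  - have : Num.sqrt eps * S c = ul - ur by rewrite Sc /d mulrC divfK// gt_eqF.
    by rewrite /S mulrDr; lra.
move=> [u r] /intermediate_stateP[]//= lr rr uE uE'.
have mr : m < r by rewrite gt_max lr rr.
have Sr : S r = d.
  apply: (canRL (mulfK _)); first by rewrite gt_eqF.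
  by rewrite /S mulrDl; lra.
suff cr : c = r by rewrite uE cr.
have [rc|cr|//] := ltgtP r c.
- by have := S_lt r c (ltW mr) rc; rewrite Sr Sc ltxx.
- by have := S_lt c r (ltW mc) cr; rewrite Sr Sc ltxx.
Unshelve. all: by end_near. Qed.

End IntermediateState.

(** * Asymptotics of the intermediate state *)

Section Asymptotics.
Context {R : realType}.
Implicit Types a r u v s eps : R.

(** The speed that conserves velocity is the one that conserves mass,
    v + r (u - v) / (r - a). *)
Lemma shock_speedE eps u r v a : u != v -> r != a -> r + a != 0 ->
  (u - v) ^+ 2 * (r + a) = eps * (2 * (r - a) * (pressure r - pressure a)) ->
  shock_speed eps (u, r) (v, a) = v + r * (u - v) / (r - a).
Proof.
rewrite /shock_speed/= -subr_eq0 -(subr_eq0 r) => uv ra rpa h.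
have -> : eps * (pressure r - pressure a) / (u - v) =
    (u - v) * (r + a) / (2 * (r - a)).
  apply/eqP; rewrite eqr_div// ?mulf_neq0//; apply/eqP.
  by move: (pressure r) (pressure a) h => P Q h; lra.
by field.
Qed.

Variables (ul ur rhol rhor : R) (w : R -> R * R).
Hypotheses (l0 : 0 < rhol) (r0 : 0 < rhor) (uru : ur < ul).
Hypothesis hw : \forall eps \near (0 : R)^'+,
  intermediate_state eps (ul, rhol) (ur, rhor) (w eps).

Let u eps := (w eps).1.
Let r eps := (w eps).2.
Let s1 eps := shock_speed eps (w eps) (ul, rhol).
Let s2 eps := shock_speed eps (w eps) (ur, rhor).

Let on_shock_curves eps : Prop :=
  [/\ rhol < r eps, rhor < r eps,
      u eps = ul - Num.sqrt eps * shock_strength rhol (r eps) &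
      u eps = ur + Num.sqrt eps * shock_strength rhor (r eps)].

Let near_state : \forall eps \near (0 : R)^'+, on_shock_curves eps.
Proof.
near=> eps.
have e0 : 0 < eps by near: eps; exact: nbhs_right_gt.
by apply/intermediate_stateP => //; near: eps.
Unshelve. all: by end_near. Qed.

(** The strengths add up to (ul - ur) / sqrt eps, which tends to infinity,
    whereas they stay bounded on bounded sets of densities. *)
Lemma cvg_intermediate_density : (w eps).2 @[eps --> 0^'+] --> +oo.
Proof.
apply/cvgryPge => A.
pose M := Num.max A (Num.max rhol rhor).
have lM : rhol <= M by rewrite !le_max lexx orbT.
have rM : rhor <= M by rewrite !le_max lexx !orbT.
near=> eps.
have e0 : 0 < eps by near: eps; exact: nbhs_right_gt.
have [lr rr uE uE'] : on_shock_curves eps by near: eps.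
rewrite leNgt; apply/negP => rA.
have rM' : r eps < M by rewrite lt_max rA.
have : Num.sqrt eps * (shock_strength rhol M + shock_strength rhor M) < ul - ur.
  by near: eps; apply: near0_sqrt_mul_lt; rewrite subr_gt0.
apply/negP; rewrite -leNgt.
have -> : ul - ur = Num.sqrt eps *
    (shock_strength rhol (r eps) + shock_strength rhor (r eps)).
  by rewrite mulrDr; lra.
rewrite ler_wpM2l ?sqrtr_ge0// lerD// ltW// shock_strength_lt// ltW//.
Unshelve. all: by end_near. Qed.

(** The first shock takes the fraction H(rhol, r) / (H(rhol, r) + H(rhor, r)) of
    the velocity jump, and both strengths are equivalent to sqrt(2 p(r)). *)
Lemma cvg_intermediate_velocity :
  (w eps).1 @[eps --> 0^'+] --> (ul + ur) / 2.
Proof.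
pose h a eps := shock_strength a (r eps) / Num.sqrt (2 * pressure (r eps)).
have h1 a : 0 < a -> h a eps @[eps --> 0^'+] --> (1 : R).
  move=> a0; apply: (@cvg_comp _ _ _ r
    (fun r => shock_strength a r / Num.sqrt (2 * pressure r))).
    exact: cvg_intermediate_density.
  exact: shock_strength_equiv.
have -> : (ul + ur) / 2 = ul - (ul - ur) * (1 * (1 + 1)^-1) :> R by field.
have : ul - (ul - ur) * (h rhol eps * (h rhol eps + h rhor eps)^-1)
    @[eps --> 0^'+] --> ul - (ul - ur) * (1 * (1 + 1)^-1).
  apply: cvgB; first exact: cvg_cst.
  apply: cvgM; first exact: cvg_cst.
  apply: cvgM; first exact: h1.
  by apply: cvgV; [rewrite gt_eqF|apply: cvgD; exact: h1].
apply: cvg_trans; apply: near_eq_cvg; near=> eps.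
have e0 : 0 < eps by near: eps; exact: nbhs_right_gt.
have [lr rr uE uE'] : on_shock_curves eps by near: eps.
have re0 := lt_trans l0 lr.
have p0 : 0 < pressure (r eps).
  by rewrite (le_lt_trans (pressure_ge0 rhol (ltW l0)))// pressure_lt// ltW.
have q0 : 0 < Num.sqrt (2 * pressure (r eps)) by rewrite sqrtr_gt0 mulr_gt0.
rewrite -/(u eps) uE.
have -> : ul - ur = Num.sqrt eps *
    (shock_strength rhol (r eps) + shock_strength rhor (r eps)).
  by rewrite mulrDr; lra.
have := shock_strength_gt0 rhol (r eps) l0 lr.
have := shock_strength_gt0 rhor (r eps) r0 rr.
rewrite /h; move: (shock_strength _ _) (shock_strength _ _) => x y x0 y0.
by field; rewrite !gt_eqF// addr_gt0.
Unshelve. all: by end_near. Qed.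

Let explicit_speeds eps : Prop :=
  [/\ ur < u eps < ul,
      s1 eps = ul + r eps * (u eps - ul) / (r eps - rhol) &
      s2 eps = ur + r eps * (u eps - ur) / (r eps - rhor)].

Let near_speeds : \forall eps \near (0 : R)^'+, explicit_speeds eps.
Proof.
near=> eps.
have e0 : 0 < eps by near: eps; exact: nbhs_right_gt.
have se0 : 0 < Num.sqrt eps by rewrite sqrtr_gt0.
have [lr rr uE uE'] : on_shock_curves eps by near: eps.
have Hl := mulr_gt0 se0 (shock_strength_gt0 rhol (r eps) l0 lr).
have Hr := mulr_gt0 se0 (shock_strength_gt0 rhor (r eps) r0 rr).
have speed a v : 0 < a -> a < r eps -> u eps != v ->
    (u eps - v) ^+ 2 = (Num.sqrt eps * shock_strength a (r eps)) ^+ 2 ->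
    shock_speed eps (w eps) (v, a) = v + r eps * (u eps - v) / (r eps - a).
  move=> a0 ar uv e; have ra0 : r eps + a != 0.
    by rewrite gt_eqF// addr_gt0// (lt_trans a0).
  rewrite [w eps]surjective_pairing shock_speedE// ?gt_eqF//.
  rewrite e exprMn sqr_sqrtr ?(ltW e0)// sqr_shock_strength//.
  by rewrite -!mulrA mulVf// mulr1.
split; first by apply/andP; split; lra.
- apply: speed => //; first by rewrite lt_eqF//; lra.
  by rewrite uE addrAC subrr add0r sqrrN.
- apply: speed => //; first by rewrite gt_eqF//; lra.
  by rewrite uE' addrAC subrr add0r.
Unshelve. all: by end_near. Qed.

Let cvg_speed a v : 0 < a ->
  v + r eps * (u eps - v) / (r eps - a) @[eps --> 0^'+] --> (ul + ur) / 2.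
Proof.
move=> a0.
have : v + (1 + a * (r eps - a)^-1) * (u eps - v) @[eps --> 0^'+] -->
    v + (1 + a * 0) * ((ul + ur) / 2 - v).
  apply: cvgD; first exact: cvg_cst.
  apply: cvgM; last first.
    by apply: cvgB; [exact: cvg_intermediate_velocity|exact: cvg_cst].
  apply: cvgD; first exact: cvg_cst.
  apply: cvgM; first exact: cvg_cst.
  apply: (@cvg_comp _ _ _ r (fun r => (r - a)^-1)).
    exact: cvg_intermediate_density.
  exact: cvg_inv_addr_y.
rewrite mulr0 addr0 mul1r addrC subrK; apply: cvg_trans; apply: near_eq_cvg.
near=> eps.
have ar : a < r eps.
  by near: eps; have /cvgryPgt := cvg_intermediate_density; exact.
by field; rewrite subr_eq0 gt_eqF.
Unshelve. all: by end_near. Qed.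

Lemma cvg_speed1 :
  shock_speed eps (w eps) (ul, rhol) @[eps --> 0^'+] --> (ul + ur) / 2.
Proof.
apply: cvg_trans (cvg_speed rhol ul l0); apply: near_eq_cvg.
by apply: filterS near_speeds => eps [_ <- _].
Qed.

Lemma cvg_speed2 :
  shock_speed eps (w eps) (ur, rhor) @[eps --> 0^'+] --> (ul + ur) / 2.
Proof.
apply: cvg_trans (cvg_speed rhor ur r0); apply: near_eq_cvg.
by apply: filterS near_speeds => eps [_ _ <-].
Qed.

(** The intermediate velocity separates the two speeds: mass conservation reads
    s1 = u - rhol (ul - u) / (r - rhol) and s2 = u + rhor (u - ur) / (r - rhor). *)
Lemma near_speed_lt : \forall eps \near (0 : R)^'+,
  shock_speed eps (w eps) (ul, rhol) < shock_speed eps (w eps) (ur, rhor).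
Proof.
near=> eps.
have [/andP[u1 u2] e1 e2] : explicit_speeds eps by near: eps.
have [lr rr _ _] : on_shock_curves eps by near: eps.
rewrite -/(s1 eps) -/(s2 eps) e1 e2; apply: (@lt_trans _ _ (u eps)).
  rewrite -ltrBrDl ltr_pdivrMr ?subr_gt0// -subr_gt0.
  have -> : (u eps - ul) * (r eps - rhol) - r eps * (u eps - ul) =
    rhol * (ul - u eps) by ring.
  by rewrite mulr_gt0// subr_gt0.
rewrite -ltrBlDl ltr_pdivlMr ?subr_gt0// -subr_gt0.
have -> : r eps * (u eps - ur) - (u eps - ur) * (r eps - rhor) =
    rhor * (u eps - ur) by ring.
by rewrite mulr_gt0// subr_gt0.
Unshelve. all: by end_near. Qed.

(** By mass conservation, s1 (r - rhol) = r u - rhol ul and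
    s2 (r - rhor) = r u - rhor ur; subtracting cancels the unbounded terms. *)
Lemma cvg_concentrated_mass :
  (w eps).2 * (shock_speed eps (w eps) (ur, rhor) -
               shock_speed eps (w eps) (ul, rhol)) @[eps --> 0^'+] -->
  (ul - ur) * ((rhol + rhor) / 2).
Proof.
have -> : (ul - ur) * ((rhol + rhor) / 2) =
    (rhor * ((ul + ur) / 2) - rhol * ((ul + ur) / 2))
    + (rhol * ul - rhor * ur) by field.
have : (rhor * s2 eps - rhol * s1 eps) + (rhol * ul - rhor * ur)
    @[eps --> 0^'+] --> (rhor * ((ul + ur) / 2) - rhol * ((ul + ur) / 2))
    + (rhol * ul - rhor * ur).
  apply: cvgD; last exact: cvg_cst.
  by apply: cvgB; apply: cvgM;
    [exact: cvg_cst|exact: cvg_speed2|exact: cvg_cst|exact: cvg_speed1].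
apply: cvg_trans; apply: near_eq_cvg; near=> eps.
have [_ e1 e2] : explicit_speeds eps by near: eps.
have [lr rr _ _] : on_shock_curves eps by near: eps.
rewrite -/(s1 eps) -/(s2 eps) -/(r eps) e1 e2.
by field; rewrite !subr_eq0 !gt_eqF.
Unshelve. all: by end_near. Qed.

End Asymptotics.

(** * Continuous functions on the plane are measurable *)

Section PlaneIntegrals.
Context {R : realType}.
Local Notation mu := (@lebesgue_measure R).
Local Notation plane := (measurableTypeR R * measurableTypeR R)%type.
Local Notation mu2 := (mu \x mu)%E.
Local Notation upper := [set z : R * R | 0 < z.2].

(** An open set is a countable union of squares with rational centres and radii
    1 / (n + 1); squares are rectangles, hence measurable for the product. *)
Lemma open_measurable_plane (A : set (R * R)) :
  open A -> measurable (A : set plane).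
Proof.
move=> oA.
pose sq (i : nat * (rat * rat)) : set plane :=
  ball (ratr i.2.1 : R) i.1.+1%:R^-1 `*` ball (ratr i.2.2 : R) i.1.+1%:R^-1.
have -> : A = \bigcup_(i in [set: nat * (rat * rat)])
    (if `[< sq i `<=` A >] then sq i else set0).
  apply/seteqP; split=> [[x y] Axy|z [i _]]; last by case: asboolP => [sA /sA|_ []].
  have [e /= e0 eA] : exists2 e : R, 0 < e & ball (x, y) e `<=` A.
    have /nbhs_ballP[e /= e0 eA] : nbhs (x, y) A.
      by move: oA; rewrite openE; apply.
    by exists e.
  have [n ne] : exists n : nat, n.+1%:R^-1 < e / 2 :> R.
    have /ltr_add_invr[n] : 0 < e / 2 by rewrite divr_gt0.
    by rewrite add0r => ?; exists n.
  have n0 : 0 < n.+1%:R^-1 :> R by rewrite invr_gt0.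
  have rat_near (a : R) : exists q : rat, `|a - ratr q| < n.+1%:R^-1.
    have [|q] := @rat_in_itvoo R (a - n.+1%:R^-1) (a + n.+1%:R^-1).
      by rewrite ltrBlDr -addrA ltrDl addr_gt0.
    rewrite in_itv/= => /andP[h1 h2]; exists q.
    rewrite ltr_norml ltrBrDr addrC -ltrBrDr opprK.
    by rewrite h2 ltrBlDr addrC -ltrBlDr.
  have [p px] := rat_near x; have [q qy] := rat_near y.
  exists (n, (p, q)) => //=.
  rewrite asboolT; first by split; rewrite /= /ball/= distrC.
  move=> [x' y'] [/= x'p y'q]; apply: eA; split => /=.
    rewrite /ball/= in x'p *.
    rewrite (le_lt_trans (ler_distD (ratr p) _ _))//.
    by rewrite [ltRHS]splitr ltrD// (lt_trans _ ne).
  rewrite /ball/= in y'q *.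
  rewrite (le_lt_trans (ler_distD (ratr q) _ _))//.
  by rewrite [ltRHS]splitr ltrD// (lt_trans _ ne).
apply: countable_bigcupT_measurable => // i.
by case: asboolP => // _; apply: measurableX; apply: open_measurable;
  exact: ball_open.
Qed.

Lemma continuous_measurable_plane (f : R * R -> R) :
  continuous f -> measurable_fun (setT : set plane) f.
Proof.
move=> cf; apply: (measurability _ (RGenOpens.measurableE R)).
move=> _ [_ [a [b ->] <-]]; rewrite setTI.
apply: open_measurable_plane; apply: open_comp; last exact: interval_open.
by move=> z _; exact: cf.
Qed.

End PlaneIntegrals.

(** * Integrals over thin wedges *)

Section Strips.
Context {R : realType}.
Local Notation mu := (@lebesgue_measure R).
Local Notation plane := (measurableTypeR R * measurableTypeR R)%type.
Local Notation mu2 := (mu \x mu)%E.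
Local Notation upper := [set z : R * R | 0 < z.2].

(** Measurable, bounded, and vanishing outside a square: a class that contains
    the test functions, is stable under multiplication by indicators of wedges,
    and consists of integrable functions.  One constant bounds both the values
    and the support. *)
Definition bounded_supported (f : R * R -> R) : Prop :=
  measurable_fun (setT : set plane) f /\
  exists2 M, 0 < M & forall z, `|f z| <= M /\
    (f z != 0 -> `|z.1| <= M /\ `|z.2| <= M).

Lemma measurable_upper : measurable (upper : set plane).
Proof.
have -> : upper = setT `*` `]0, +oo[%classic.
  by apply/seteqP; split=> [z /= z0|z /= []]; rewrite in_itv/= andbT.
by apply: measurableX => //; exact: measurable_itv.
Qed.

Lemma bounded_supported_integrable f (D : set plane) :
  measurable D -> bounded_supported f -> mu2.-integrable D (EFin \o f).
Proof.
move=> mD [mf [M M0 Mf]].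
apply: (@integrableS _ _ _ _ setT) => //.
pose I : set (measurableTypeR R) := `[- M, M]%classic.
have mI : measurable I by exact: measurable_itv.
(* f vanishes outside a square of finite measure and is bounded there *)
pose B : set plane := I `*` I.
have mB : measurable B by exact: measurableX.
have -> : EFin \o f = (EFin \o f) \_ B.
  apply/funext => z; rewrite patchE; case: ifPn => // /negP zB.
  have [fz0|/(Mf z).2[z1 z2]] := eqVneq (f z) 0; first by rewrite /= fz0.
  by exfalso; apply: zB; rewrite inE; split; rewrite /= /I/= in_itv/= -ler_norml.
apply: (proj1 (integrable_mkcond _ mB)); apply: measurable_bounded_integrable => //.
- rewrite [ltLHS](_ : _ =
      mu I * mu I)%E; last by exact: product_measure1E.
  by rewrite lebesgue_measure_itv/=; case: ifPn => _;
    rewrite ?mule0 ?ltry// -EFinD -EFinM ltry.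
- exact: measurable_funS mf.
- exists M; split; first exact: num_real.
  by move=> y My z _; rewrite /= (le_trans _ (ltW My))// (Mf z).1.
Qed.

Lemma bounded_supportedM (b f : R * R -> R) :
  measurable_fun (setT : set plane) b -> (forall z, `|b z| <= 1) ->
  bounded_supported f -> bounded_supported (fun z => b z * f z).
Proof.
move=> mb b1 [mf [M M0 Mf]]; split; first exact: measurable_funM.
exists M => // z; split.
  by rewrite normrM -[leRHS]mul1r ler_pM// (Mf z).1.
by rewrite mulf_eq0 negb_or => /andP[_]; exact: (Mf z).2.
Qed.

(** Valued in the field rather than in bool, so that step functions become
    algebraic identities between wedges. *)
Definition wedge (s : R) (z : R * R) : R := (z.1 < s * z.2)%R%:R.

Definition shock_line (s : R) (z : R * R) : R := (z.1 == s * z.2)%R%:R.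

Lemma measurable_boolr (b : plane -> bool) :
  measurable_fun setT b -> measurable_fun setT (fun z => (b z)%:R : R).
Proof.
move=> mb; rewrite [X in measurable_fun _ X](_ : _ =
    (fun z => if b z then 1 else 0)).
  exact: measurable_fun_ifT.
by apply/funext => z; case: (b z).
Qed.

Lemma measurable_wedge s : measurable_fun (setT : set plane) (wedge s).
Proof.
apply: measurable_boolr; apply: measurable_fun_ltr; first exact: measurable_fst.
by apply: measurable_funM => //; exact: measurable_snd.
Qed.

Lemma measurable_shock_line s :
  measurable_fun (setT : set plane) (shock_line s).
Proof.
apply: measurable_boolr; apply: measurable_fun_eqr; first exact: measurable_fst.
by apply: measurable_funM => //; exact: measurable_snd.
Qed.

Lemma wedge_norm_le1 s z : `|wedge s z| <= 1.
Proof. by rewrite /wedge; case: (_ < _); rewrite ?normr1 ?normr0. Qed.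

Lemma wedge_le s1 s2 z : s1 <= s2 -> 0 < z.2 -> wedge s1 z <= wedge s2 z.
Proof.
move=> s12 z0; rewrite /wedge ler_nat.
have [h|//] := ltP z.1 (s1 * z.2).
by rewrite (lt_le_trans h)// ler_wpM2r// ltW.
Qed.

Lemma wedgeB s1 s2 t : s1 <= s2 -> 0 < t ->
  (fun x => wedge s2 (x, t) - wedge s1 (x, t)) = \1_(`[s1 * t, s2 * t[%classic).
Proof.
move=> s12 t0; apply/funext => x; rewrite indicE /wedge/= mem_setE in_itv/=.
have st : s1 * t <= s2 * t by rewrite ler_wpM2r// ltW.
have [h|h] := ltP x (s1 * t); last by rewrite subr0.
by rewrite (lt_le_trans h st) subrr.
Qed.

Lemma wedgeB_norm_le1 s1 s2 z : `|wedge s2 z - wedge s1 z| <= 1.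
Proof.
rewrite /wedge; case: (_ < _); case: (_ < _);
  by rewrite ?subrr ?subr0 ?sub0r ?normrN ?normr1 ?normr0.
Qed.

Lemma bounded_supported_integrable1 (h : R -> R) M :
  measurable_fun setT h -> (forall t, `|h t| <= M) ->
  (forall t, M < `|t| -> h t = 0) -> mu.-integrable setT (EFin \o h).
Proof.
move=> mh hM h0.
pose I : set (measurableTypeR R) := `[- M, M]%classic.
have mI : measurable I by exact: measurable_itv.
have -> : EFin \o h = (EFin \o h) \_ I.
  apply/funext => t; rewrite patchE; case: ifPn => // /negP tI.
  rewrite /= h0// ltNge; apply/negP => tM; apply: tI.
  by rewrite inE /I/= in_itv/= -ler_norml.
apply: (proj1 (integrable_mkcond _ mI)); apply: measurable_bounded_integrable => //.
- rewrite [ltLHS](_ : _ = if (- M < M)%R then (M - - M)%:E else 0%E); last first.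
    have := @lebesgue_measure_itv R (Interval (BLeft (- M)) (BRight M)).
    by rewrite /= lte_fin.
  by case: ifPn; rewrite ltry.
- exact: measurable_funS mh.
- exists M; split; first exact: num_real.
  by move=> y My t _; rewrite /= (le_trans _ (ltW My)).
Qed.

(** The factor 1_(0 < t) is what bounds the support from below in t, g being
    controlled only for large t. *)
Lemma strip_bounded_supported s1 s2 (g : R -> R) M : s1 <= s2 ->
  measurable_fun setT g -> (forall t, `|g t| <= M) ->
  (forall t, M < t -> g t = 0) ->
  bounded_supported (fun z =>
    (wedge s2 z - wedge s1 z) * ((0 < z.2)%R%:R * g z.2)).
Proof.
move=> s12 mg gM gM0.
have M0 : 0 <= M by rewrite (le_trans _ (gM 0)).
pose c (t : R) : R := (0 < t)%R%:R.
have c1 t : `|c t| <= 1 by rewrite /c; case: (_ < _); rewrite ?normr1 ?normr0.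
split.
  apply: measurable_funM.
    by apply: measurable_funB; exact: measurable_wedge.
  apply: measurable_funM; last first.
    by apply: measurableT_comp => //; exact: measurable_snd.
  apply: (measurable_boolr (fun z : plane => 0 < z.2)).
  by apply: (@measurable_fun_ltr _ plane R setT (fun=> 0) snd).
(* x ranges between s1 t and s2 t, with 0 < t <= M *)
pose K := (1 + `|s1| + `|s2|) * M.
have MK : M <= K by rewrite ler_peMl// -addrA lerDl addr_ge0.
have s1K : `|s1| * M <= K by rewrite ler_wpM2r// addrAC lerDr addr_ge0.
have s2K : `|s2| * M <= K by rewrite ler_wpM2r// lerDr addr_ge0.
have K0 : 0 <= K := le_trans M0 MK.
exists (K + 1); first by rewrite ltr_wpDl.
move=> [x t]; split.
  rewrite (@le_trans _ _ K)//; last by rewrite lerDl.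
  rewrite (le_trans _ MK)// !normrM/= -[leRHS]mul1r ler_pM//.
    exact: wedgeB_norm_le1.
  by rewrite -[leRHS]mul1r ler_pM//; exact: c1.
rewrite /= !mulf_eq0 !negb_or => /and3P[w0].
have [t0 _ gt|//] := ltP 0 t; last by rewrite eqxx.
have tM : t <= M by rewrite leNgt; apply: contra gt => /gM0 ->.
split; last by rewrite ger0_norm ?(ltW t0)// (le_trans tM)// (le_trans MK)// lerDl.
have bound s : s * t <= `|s| * M.
  by rewrite (le_trans (ler_norm _))// normrM (gtr0_norm t0) ler_wpM2l.
have boundN s : - (s * t) <= `|s| * M.
  by rewrite -mulNr (le_trans (bound _))// normrN.
move: w0; rewrite /wedge/=.
have st : s1 * t <= s2 * t by rewrite ler_wpM2r// ltW.
have [h1|h1] := ltP x (s1 * t).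
  by rewrite (lt_le_trans h1 st) subrr eqxx.
have [h2 _|h2] := ltP x (s2 * t); last by rewrite subrr eqxx.
rewrite ler_norml; have := bound s2; have := boundN s1.
by move=> b1 b2; apply/andP; split; lra.
Qed.

Lemma strip_integrable s1 s2 (g : R -> R) M : s1 <= s2 ->
  measurable_fun setT g -> (forall t, `|g t| <= M) ->
  (forall t, M < t -> g t = 0) ->
  mu2.-integrable upper
    (EFin \o (fun z => (wedge s2 z - wedge s1 z) * g z.2)).
Proof.
move=> s12 mg gM gM0.
have := bounded_supported_integrable _ _ measurable_upper
  (strip_bounded_supported s1 s2 g M s12 mg gM gM0).
apply: eq_integrable; first exact: measurable_upper.
by move=> z; rewrite inE /= => z0; rewrite z0 mul1r.
Qed.

(** Fubini's theorem, integrating in x first: the slice at height t is an interval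
    of length (s2 - s1) t. *)
Lemma strip_integral s1 s2 (g : R -> R) M : s1 <= s2 ->
  measurable_fun setT g -> (forall t, `|g t| <= M) ->
  (forall t, M < t -> g t = 0) ->
  Rintegral mu2 upper (fun z => (wedge s2 z - wedge s1 z) * g z.2) =
  (s2 - s1) * Rintegral mu `]0, +oo[ (fun t => t * g t).
Proof.
move=> s12 mg gM gM0.
have M0 : 0 <= M by rewrite (le_trans _ (gM 0)).
pose c (t : R) : R := (0 < t)%R%:R.
pose F (z : R * R) := (wedge s2 z - wedge s1 z) * (c z.2 * g z.2).
have bF : bounded_supported F by exact: strip_bounded_supported s12 mg gM gM0.
have -> : Rintegral mu2 upper (fun z => (wedge s2 z - wedge s1 z) * g z.2) =
    Rintegral mu2 setT F.
  rewrite Rintegral_mkcond; apply: eq_Rintegral => -[x t] _.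
  rewrite patchE /F /c /=; have [t0|t0] := ltP 0 t.
    by rewrite mem_set//= mul1r.
  by rewrite memNset ?mul0r ?mulr0//=; apply/negP; rewrite -leNgt.
have -> : Rintegral mu `]0, +oo[ (fun t => t * g t) =
    Rintegral mu setT (fun t => c t * (t * g t)).
  rewrite Rintegral_mkcond; apply: eq_Rintegral => t _.
  rewrite patchE /c; have [t0|t0] := ltP 0 t.
    by rewrite mem_set/= ?in_itv/= ?t0// mul1r.
  by rewrite memNset ?mul0r//= in_itv/= ltNge t0.
rewrite -RintegralZl//; last first.
  apply: (@bounded_supported_integrable1 _ (M + M * M)).
  - apply: measurable_funM; last exact: measurable_funM.
    rewrite [X in measurable_fun _ X](_ : _ =
        (fun t : R => if 0 < t then 1 else 0)).
      by apply: measurable_fun_ifT => //; exact: measurable_fun_ltr.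
    by apply/funext => t; rewrite /c; case: (_ < _).
  - move=> t; rewrite /c; have [t0|t0] := ltP 0 t; last first.
      by rewrite mul0r normr0 addr_ge0// mulr_ge0.
    have [tM|/gM0 ->] := leP t M; last by rewrite !mulr0 normr0 addr_ge0// mulr_ge0.
    rewrite mul1r normrM (gtr0_norm t0) (@le_trans _ _ (M * M))//.
      by rewrite ler_pM// ltW.
    by rewrite lerDr.
  - move=> t; rewrite /c; have [t0|t0] := ltP 0 t; last by rewrite mul0r.
    rewrite (gtr0_norm t0) => Mt; rewrite gM0 ?mulr0//.
    by rewrite (le_lt_trans _ Mt)// lerDl mulr_ge0.
rewrite /Rintegral -integral21_prod_meas1; last first.
  exact: bounded_supported_integrable.
congr fine; apply: eq_integral => t _; rewrite /fubini_G.
rewrite /F /=; have [t0|t0] := ltP 0 t; last first.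
  rewrite /c ltNge t0/= !mul0r mulr0.
  by apply: integral0_eq => x _; rewrite mulr0.
rewrite /c t0 !mul1r.
pose I : set (measurableTypeR R) := `[s1 * t, s2 * t[%classic.
have mI : measurable I by exact: measurable_itv.
have -> : (\int[mu]_x ((wedge s2 (x, t) - wedge s1 (x, t)) * g t)%:E =
    \int[mu]_(x in I) (g t)%:E)%E.
  rewrite [RHS]integral_mkcond; apply: eq_integral => x _.
  rewrite (_ : wedge s2 (x, t) - wedge s1 (x, t) = \1_I x); last first.
    by rewrite -(wedgeB s1 s2 t s12 t0).
  by rewrite patchE indicE; case: (x \in I); rewrite ?mul1r ?mul0r.
rewrite integral_cst//.
have := @lebesgue_measure_itv R (Interval (BLeft (s1 * t)) (BLeft (s2 * t))).
rewrite /= lte_fin => muI; rewrite [X in (_ * X)%E]muI.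
have [st|st] := ltP (s1 * t) (s2 * t).
  by rewrite -EFinD -EFinM; congr EFin; ring.
have -> : s2 = s1.
  by apply/eqP; rewrite eq_le s12 andbT -(ler_pM2r t0).
by rewrite mule0 subrr mul0r.
Qed.

End Strips.

(** * Differentiating with respect to the shock speed *)

Section SpeedDerivative.
Context {R : realType}.
Local Notation mu := (@lebesgue_measure R).
Local Notation plane := (measurableTypeR R * measurableTypeR R)%type.
Local Notation mu2 := (mu \x mu)%E.
Local Notation upper := [set z : R * R | 0 < z.2].

Lemma continuous_test_function (phi : R * R -> R) :
  test_function phi -> continuous phi.
Proof. by move=> [/(_ 0%N)]. Qed.

Lemma test_function_bounded_supported (phi : R * R -> R) :
  test_function phi -> bounded_supported phi.
Proof.
move=> tphi; have cphi := continuous_test_function phi tphi.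
have [_ cK _] := tphi; set K := closure _ in cK.
split; first exact: continuous_measurable_plane.
have [M1 [_ hM1]] := compact_bounded cK.
have cphiK : compact (phi @` K).
  by apply: continuous_compact => //; exact: continuous_subspaceT.
have [M2 [_ hM2]] := compact_bounded cphiK.
pose M := `|M1| + `|M2| + 1.
have M0 : 0 < M by rewrite ltr_wpDl// addr_ge0.
have [n1 n2] : 0 <= `|M1| /\ 0 <= `|M2| by [].
have M1M : M1 < M by have := ler_norm M1; rewrite /M; lra.
have M2M : M2 < M by have := ler_norm M2; rewrite /M; lra.
exists M => // z; split.
  have [->|z0] := eqVneq (phi z) 0; first by rewrite normr0 ltW.
  by apply: (hM2 _ M2M); exists z => //; exact: subset_closure.
move=> z0; have Kz : K z by exact: subset_closure.
by have := hM1 _ M1M z Kz; rewrite /= prod_normE /= ge_max => /andP[].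
Qed.

(** Compactness of [0, M], in its near-covering form, makes the continuity of
    phi in the x direction uniform along the ray x = sigma t. *)
Lemma uniform_on_ray (phi : R * R -> R) (sigma M e : R) :
  continuous phi -> 0 < e ->
  \forall h \near (0 : R), forall t, t \in `[0, M] ->
    `|phi (sigma * t + h, t) - phi (sigma * t, t)| < e.
Proof.
move=> cphi e0.
have : \forall h \near (0 : R), `[0, M]%classic `<=`
    (fun t => `|phi (sigma * t + h, t) - phi (sigma * t, t)| < e).
  have /compact_near_coveringP := @segment_compact R 0 M.
  move=> /(_ R (nbhs (0 : R)) (fun h t =>
    `|phi (sigma * t + h, t) - phi (sigma * t, t)| < e)); apply => t _.
  have : phi (sigma * y.1 + y.2, y.1) - phi (sigma * y.1, y.1)
      @[y --> (t, 0 : R)] --> phi (sigma * t + 0, t) - phi (sigma * t, t).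
    have d1 : y.1 @[y --> (t, 0 : R)] --> t by exact: cvg_fst.
    have d2 : y.2 @[y --> (t, 0 : R)] --> (0 : R) by exact: cvg_snd.
    have c1 : sigma * y.1 @[y --> (t, 0 : R)] --> sigma * t.
      exact: (cvgM (cvg_cst sigma) d1).
    have c2 : (sigma * y.1 + y.2, y.1) @[y --> (t, 0 : R)] -->
        (sigma * t + 0, t).
      apply: (@cvg_pair _ _ _ _ (nbhs (sigma * t + 0)) (nbhs t)) => //; exact: cvgD.
    have c3 : (sigma * y.1, y.1) @[y --> (t, 0 : R)] --> (sigma * t, t).
      exact: (@cvg_pair _ _ _ _ (nbhs (sigma * t)) (nbhs t)).
    exact: (cvgB (cvg_comp _ _ c2 (cphi _)) (cvg_comp _ _ c3 (cphi _))).
  by rewrite addr0 subrr => /cvgr0_norm_lt/(_ e e0).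
by apply: filterS => h hK t tM; apply: hK.
Qed.

(** A function dominated by k times the indicator of the wedge has an integral of
    order k (s2 - s1), with a constant depending only on the height of the
    support; it is used both for the remainder of the derivative of J and for
    the negligibility of a single ray. *)
Lemma strip_dominated (M : R) : 0 <= M -> exists2 C, 0 <= C &
  forall s1 s2 k (psi : R * R -> R), s1 <= s2 -> 0 <= k ->
  mu2.-integrable upper (EFin \o psi) ->
  (forall z, 0 < z.2 -> `|psi z| <=
     k * ((wedge s2 z - wedge s1 z) * (z.2 <= M)%R%:R)) ->
  `|Rintegral mu2 upper psi| <= k * C * (s2 - s1).
Proof.
move=> M0; pose g (t : R) : R := (t <= M)%R%:R.
have mg : measurable_fun setT g.
  rewrite (_ : g = (fun t => if t <= M then 1 else 0)).
    by apply: measurable_fun_ifT => //; exact: measurable_fun_ler.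
  by apply/funext => t; rewrite /g; case: (_ <= _).
have gM t : `|g t| <= M + 1.
  by rewrite /g; case: (t <= M); rewrite ?normr1 ?normr0; lra.
have gM0 t : M + 1 < t -> g t = 0.
  move=> Mt; rewrite /g leNgt (_ : M < t)//.
  by rewrite (lt_trans _ Mt)// ltrDl.
exists (Rintegral mu `]0, +oo[ (fun t => t * g t)).
  apply: Rintegral_ge0 => t; rewrite /= in_itv/= andbT => t0.
  by rewrite mulr_ge0 ?ler0n// ltW.
move=> s1 s2 k psi s12 k0 ipsi psik.
have mU := @measurable_upper R.
have ig := strip_integrable s1 s2 g _ s12 mg gM gM0.
rewrite -mulrA [X in k * X]mulrC -(strip_integral s1 s2 g _ s12 mg gM gM0).
rewrite -RintegralZl//.
apply: (le_trans (le_normr_Rintegral mU ipsi)).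
apply: le_Rintegral => //.
- exact: integrable_norm.
- exact: (integrableZl mU k ig).
Qed.

Definition left_pairing (phi : R * R -> R) (s : R) : R :=
  Rintegral mu2 upper (fun z => wedge s z * phi z).

Lemma wedge_integrable phi s : bounded_supported phi ->
  mu2.-integrable upper (EFin \o (fun z => wedge s z * phi z)).
Proof.
move=> bphi; apply: bounded_supported_integrable; first exact: measurable_upper.
apply: bounded_supportedM => //; first exact: measurable_wedge.
exact: wedge_norm_le1.
Qed.

(** On the wedge between x = s1 t and x = s2 t, replace phi(x, t) by
    phi(sigma t, t): [strip_integral] computes the resulting integral exactly,
    and the error is at most k (s2 - s1) times a constant, where k is the
    oscillation of phi controlled by [uniform_on_ray].  The estimate is uniform
    in the pair (s1, s2) because both speeds move with eps. *)
Lemma strict_derivative_left_pairing (phi : R * R -> R) (sigma e : R) :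
  continuous phi -> bounded_supported phi -> 0 < e ->
  exists2 eta, 0 < eta & forall s1 s2, s1 <= s2 ->
    `|s1 - sigma| < eta -> `|s2 - sigma| < eta ->
  `|left_pairing phi s2 - left_pairing phi s1 -
     (s2 - s1) * Rintegral mu `]0, +oo[ (fun t => t * phi (sigma * t, t))|
  <= e * (s2 - s1).
Proof.
move=> cphi bphi e0; have [mphi [M M0 hM]] := bphi.
have [C C0 dom] := strip_dominated M (ltW M0).
(* C may vanish, hence the shift by 1. *)
pose k := e / (C + 1).
have k0 : 0 < k by rewrite divr_gt0// ltr_wpDl.
have [/= d d0 hd] : exists2 d, 0 < d & forall h, `|h| < d ->
    forall t, t \in `[0, M] ->
    `|phi (sigma * t + h, t) - phi (sigma * t, t)| < k.
  have /nbhs_ballP[d /= d0 hd] := uniform_on_ray phi sigma M k cphi k0.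
  by exists d => // h hlt; apply: hd; rewrite /ball/= sub0r normrN.
pose g t := phi (sigma * t, t).
have phi0 t x : M < t -> phi (x, t) = 0.
  move=> Mt; apply/eqP; apply: contraT => /(hM (x, t)).2[_ /=].
  by rewrite leNgt (lt_le_trans Mt)// ler_norm.
have mg : measurable_fun setT g.
  apply: continuous_measurable_fun => t.
  have c1 : sigma * y @[y --> t] --> sigma * t.
    exact: (cvgM (cvg_cst sigma) cvg_id).
  have c3 : (sigma * y, y) @[y --> t] --> (sigma * t, t).
    exact: (@cvg_pair _ _ _ _ (nbhs (sigma * t)) (nbhs t)).
  exact: (cvg_comp _ _ c3 (cphi _)).
have gM t : `|g t| <= M by exact: (hM _).1.
have gM0 t : M < t -> g t = 0 by exact: phi0.
(* Below height M, speeds within d / M of sigma stay within d of the ray. *)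
exists (d / M); first by rewrite divr_gt0.
move=> s1 s2 s12 s1d s2d.
have mU := @measurable_upper R.
have ig := strip_integrable s1 s2 g _ s12 mg gM gM0.
rewrite -(strip_integral s1 s2 g M)// /left_pairing.
have w1 := wedge_integrable phi s1 bphi.
have w2 := wedge_integrable phi s2 bphi.
have w12 := integrableB mU w2 w1.
rewrite -RintegralB// -RintegralB//.
have -> : e * (s2 - s1) = k * (C + 1) * (s2 - s1).
  by rewrite /k divfK// gt_eqF// ltr_wpDl.
apply: (@le_trans _ _ (k * C * (s2 - s1))); last first.
  by rewrite ler_wpM2r ?subr_ge0// ler_wpM2l ?(ltW k0)// lerDl.
apply: dom => //; first exact: ltW.
  exact: (integrableB mU w12 ig).
move=> [x t]/= t0.
rewrite -mulrBl -mulrBr normrM.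
rewrite ger0_norm ?subr_ge0 ?wedge_le//.
have [tM|Mt] := leP t M; last first.
  by rewrite /g !phi0// subrr normr0 !mulr0.
rewrite mulr1 mulrC.
have st : s1 * t <= s2 * t by rewrite ler_wpM2r// ltW.
have [h1|h1] := ltP x (s1 * t).
  by rewrite /wedge/= h1 (lt_le_trans h1 st) subrr !mulr0.
have [h2|h2] := ltP x (s2 * t); last first.
  by rewrite /wedge/= !ltNge h1 h2 subrr !mulr0.
rewrite ler_wpM2r ?subr_ge0 ?wedge_le// /g.
have -> : x = sigma * t + (x - sigma * t) by ring.
apply/ltW/hd; last by rewrite in_itv/= (ltW t0).
move: s1d s2d; rewrite !ltr_pdivlMr// => s1d s2d.
have b s : `|s - sigma| * M < d -> `|s * t - sigma * t| < d.
  move=> sd; rewrite -mulrBl normrM (gtr0_norm t0) (le_lt_trans _ sd)//.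
  by rewrite ler_wpM2l.
have := b _ s1d; have := b _ s2d; rewrite !ltr_norml.
by move=> /andP[? ?] /andP[? ?]; apply/andP; split; lra.
Qed.

(** The ray x = sigma t lies in the wedge between the speeds sigma and sigma + k
    for every k > 0, and [strip_dominated] bounds the integral over that wedge by
    a multiple of k. *)
Lemma shock_line_integral0 (phi : R * R -> R) sigma :
  bounded_supported phi ->
  mu2.-integrable upper (EFin \o (fun z => shock_line sigma z * phi z)) /\
  Rintegral mu2 upper (fun z => shock_line sigma z * phi z) = 0.
Proof.
move=> bphi; have [mphi [M M0 hM]] := bphi.
have i0 : mu2.-integrable upper (EFin \o (fun z => shock_line sigma z * phi z)).
  apply: bounded_supported_integrable; first exact: measurable_upper.
  apply: bounded_supportedM => //; first exact: measurable_shock_line.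
  by move=> z; rewrite /shock_line; case: (_ == _); rewrite ?normr1 ?normr0.
split=> //; have [C C0 dom] := strip_dominated M (ltW M0).
apply/eqP; rewrite -normr_le0; apply/ler_addgt0Pr => e e0; rewrite add0r.
pose k := e / (M * C + 1).
have MC0 : 0 < M * C + 1 by rewrite ltr_wpDl// mulr_ge0// ltW.
have k0 : 0 < k by rewrite divr_gt0.
apply: (@le_trans _ _ (M * C * (sigma + k - sigma))); last first.
  rewrite addrAC subrr add0r /k mulrA ler_pdivrMr// mulrDr mulr1 mulrC.
  by rewrite lerDl ltW.
apply: dom => //; [by rewrite lerDl ltW|exact: ltW|].
move=> [x t]/= t0; rewrite /shock_line /wedge/=.
have [->|_] := eqVneq x (sigma * t); last first.
  by rewrite mul0r normr0 mulr_ge0 ?(ltW M0)// mulr_ge0// subr_ge0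
    (wedge_le sigma (sigma + k) (x, t))// lerDl ltW.
rewrite ltxx ltr_pM2r// ltrDl k0 subr0 !mul1r.
have [tM|Mt] := leP t M; first by rewrite mulr1 (hM _).1.
rewrite mulr0; have [->|/(hM (_, t)).2[_ /=]] := eqVneq (phi (sigma * t, t)) 0.
  by rewrite normr0.
by rewrite leNgt (lt_le_trans Mt)// ler_norm.
Qed.

(** A step function is a combination of the indicators of the two wedges and of a
    constant. *)
Lemma step_integral (phi : R * R -> R) s1 s2 a b c :
  bounded_supported phi -> s1 <= s2 ->
  regular_distr (fun z => if z.1 < s1 * z.2 then a
                          else if z.1 < s2 * z.2 then b else c) phi =
  (a - b) * left_pairing phi s1 + (b - c) * left_pairing phi s2
  + c * Rintegral mu2 upper phi.
Proof.
move=> bphi s12; have mU := @measurable_upper R.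
have w1 := wedge_integrable phi s1 bphi.
have w2 := wedge_integrable phi s2 bphi.
have w0 := bounded_supported_integrable phi _ mU bphi.
have i1 := integrableZl mU (a - b) w1.
have i2 := integrableZl mU (b - c) w2.
have i0 := integrableZl mU c w0.
have i12 := integrableD mU i1 i2.
rewrite /left_pairing -!RintegralZl//.
rewrite -RintegralD// -RintegralD//.
apply: eq_Rintegral => -[x t]; rewrite inE/= => t0; rewrite /wedge/=.
have st : s1 * t <= s2 * t by rewrite ler_wpM2r// ltW.
have [h1|h1] := ltP x (s1 * t); first by rewrite (lt_le_trans h1 st) /=; ring.
by case: ltP => _ /=; ring.
Qed.

End SpeedDerivative.

(** * Passage to the limit *)

Section Limits.
Context {R : realType}.
Local Notation mu := (@lebesgue_measure R).
Local Notation plane := (measurableTypeR R * measurableTypeR R)%type.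
Local Notation mu2 := (mu \x mu)%E.
Local Notation upper := [set z : R * R | 0 < z.2].

(** A function with a single jump across x = sigma t; its values on the line
    itself, accounted for by d, do not contribute. *)
Lemma jump_integral (phi f : R * R -> R) sigma a c d :
  bounded_supported phi ->
  (forall z, f z = (a - c) * wedge sigma z + c + d * shock_line sigma z) ->
  regular_distr f phi =
  (a - c) * left_pairing phi sigma + c * Rintegral mu2 upper phi.
Proof.
move=> bphi fE; have mU := @measurable_upper R.
have [il l0] := shock_line_integral0 phi sigma bphi.
have w1 := wedge_integrable phi sigma bphi.
have i1 := integrableZl mU (a - c) w1.
have w0 := bounded_supported_integrable phi _ mU bphi.
have i0 := integrableZl mU c w0.
have i2 := integrableZl mU d il.
have i10 := integrableD mU i1 i0.
have -> : (a - c) * left_pairing phi sigma + c * Rintegral mu2 upper phi =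
    (a - c) * left_pairing phi sigma + c * Rintegral mu2 upper phi
    + d * Rintegral mu2 upper (fun z => shock_line sigma z * phi z).
  by rewrite l0 mulr0 addr0.
rewrite /left_pairing -!RintegralZl//.
rewrite -RintegralD// -RintegralD//.
by apply: eq_Rintegral => z _; rewrite fE; ring.
Qed.

Lemma line_delta_linear (phi : R * R -> R) sigma k :
  continuous phi -> bounded_supported phi ->
  line_delta (fun t => k * t) (fun t => sigma * t) phi =
  k * Rintegral mu `]0, +oo[ (fun t => t * phi (sigma * t, t)).
Proof.
move=> cphi [_ [M M0 hM]]; rewrite /line_delta.
under eq_Rintegral do rewrite -mulrA.
rewrite RintegralZl//.
apply: (@integrableS _ _ _ _ setT) => //.
apply: (@bounded_supported_integrable1 _ _ (M + M * M)).
- apply: continuous_measurable_fun => t.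
  have c1 : sigma * y @[y --> t] --> sigma * t.
    exact: (cvgM (cvg_cst sigma) cvg_id).
  have c3 : (sigma * y, y) @[y --> t] --> (sigma * t, t).
    exact: (@cvg_pair _ _ _ _ (nbhs (sigma * t)) (nbhs t)).
  exact: (cvgM cvg_id (cvg_comp _ _ c3 (cphi _))).
- move=> t; have [->|p0] := eqVneq (phi (sigma * t, t)) 0.
    by rewrite mulr0 normr0 addr_ge0 ?mulr_ge0 ?(ltW M0).
  have [_ /= tM] := (hM (sigma * t, t)).2 p0.
  rewrite normrM (@le_trans _ _ (M * M))//; last by rewrite lerDr ltW.
  by rewrite ler_pM// (hM _).1.
- move=> t Mt; have [->|p0] := eqVneq (phi (sigma * t, t)) 0; first exact: mulr0.
  have [_ /= tM] := (hM (sigma * t, t)).2 p0.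
  have : M < M by rewrite (lt_le_trans _ tM)// (le_lt_trans _ Mt)// lerDl mulr_ge0// ltW.
  by rewrite ltxx.
Qed.

(** Strict differentiability at sigma makes J Lipschitz at sigma. *)
Lemma cvg_left_pairing (phi : R * R -> R) (sigma : R) (s : R -> R) {F : set_system R}
    {FF : Filter F} : continuous phi -> bounded_supported phi ->
  s eps @[eps --> F] --> sigma ->
  left_pairing phi (s eps) @[eps --> F] --> left_pairing phi sigma.
Proof.
move=> cphi bphi ss; have [eta eta0 H] :=
  strict_derivative_left_pairing phi sigma 1 cphi bphi ltr01.
set B := Rintegral _ _ _ in H.
have {}H x : `|x - sigma| < eta ->
    `|left_pairing phi sigma - left_pairing phi x| <= `|sigma - x| * (1 + `|B|).
  move=> xs; have s0 : `|sigma - sigma| < eta by rewrite subrr normr0.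
  rewrite mulrDr mulr1 -(normrM _ B).
  have [xl|xl] := leP x sigma.
    have := H x sigma xl xs s0.
    rewrite mul1r (ger0_norm (_ : 0 <= sigma - x)) ?subr_ge0// => h.
    rewrite -[X in `|X|](subrK ((sigma - x) * B)).
    by rewrite (le_trans (ler_normD _ _))// lerD2r.
  have := H sigma x (ltW xl) s0 xs.
  rewrite mul1r [`|sigma - x|]distrC (ger0_norm (_ : 0 <= x - sigma)); last first.
    by rewrite subr_ge0 ltW.
  move=> h; rewrite distrC -[X in `|X|](subrK ((x - sigma) * B)).
  rewrite (le_trans (ler_normD _ _))// lerD//.
  by rewrite !normrM distrC.
apply/cvgrPdist_le => e e0.
have B0 : 0 < 1 + `|B| by rewrite ltr_pwDl.
near=> eps; apply: (le_trans (H _ _)).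
  by rewrite distrC; near: eps; apply: cvgr_dist_lt.
rewrite -ler_pdivlMr//; near: eps; apply: cvgr_dist_le => //.
by rewrite divr_gt0.
Unshelve. all: by end_near. Qed.

(** m (J(s2) - J(s1)) is m (s2 - s1) times a difference quotient of J, which tends
    to the derivative of J at sigma: a mass m spread over a vanishing wedge
    turns into a delta distribution on the ray. *)
Lemma cvg_mass_left_pairing (phi : R * R -> R) (sigma K : R) (s1 s2 m : R -> R)
    {F : set_system R} {FF : Filter F} :
  continuous phi -> bounded_supported phi ->
  (\forall eps \near F, s1 eps < s2 eps) ->
  s1 eps @[eps --> F] --> sigma -> s2 eps @[eps --> F] --> sigma ->
  m eps * (s2 eps - s1 eps) @[eps --> F] --> K ->
  m eps * (left_pairing phi (s2 eps) - left_pairing phi (s1 eps))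
    @[eps --> F] -->
  K * Rintegral mu `]0, +oo[ (fun t => t * phi (sigma * t, t)).
Proof.
move=> cphi bphi s12 s1s s2s mK; set B := Rintegral _ _ _.
pose Q eps := (left_pairing phi (s2 eps) - left_pairing phi (s1 eps))
              / (s2 eps - s1 eps).
have QB : Q eps @[eps --> F] --> B.
  apply/cvgrPdist_le => e e0.
  have [eta eta0 H] := strict_derivative_left_pairing phi sigma e cphi bphi e0.
  near=> eps.
  have s12e : s1 eps < s2 eps by near: eps.
  have d0 : 0 < s2 eps - s1 eps by rewrite subr_gt0.
  suff : `|(Q eps - B) * (s2 eps - s1 eps)| <= e * (s2 eps - s1 eps).
    by rewrite normrM (gtr0_norm d0) ler_pM2r// distrC.
  rewrite /Q mulrBl divfK ?gt_eqF// [B * _]mulrC; apply: H; first exact: ltW.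
  - by rewrite distrC; near: eps; apply: cvgr_dist_lt.
  - by rewrite distrC; near: eps; apply: cvgr_dist_lt.
apply: cvg_trans (cvgM mK QB); apply: near_eq_cvg; near=> eps.
have s12e : s1 eps < s2 eps by near: eps.
by rewrite /Q /=; field; rewrite subr_eq0 gt_eqF.
Unshelve. all: by end_near. Qed.

Lemma limit_u_wedge (ul ur : R) z : limit_u ul ur z =
  (ul - ur) * wedge ((ul + ur) / 2) z + ur
  + ((ul + ur) / 2 - ur) * shock_line ((ul + ur) / 2) z.
Proof.
rewrite /limit_u /wedge /shock_line.
by case: ltgtP => _ /=; ring.
Qed.

Lemma limit_rho_wedge (sigma rhol rhor : R) (z : R * R) :
  rhol * \1_[set y : R * R | y.1 < sigma * y.2] z
    + rhor * \1_[set y : R * R | y.1 > sigma * y.2] z =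
  (rhol - rhor) * wedge sigma z + rhor + (- rhor) * shock_line sigma z.
Proof.
have indE (P : pred (R * R)) : \1_[set y : R * R | P y] z = (P z)%:R :> R.
  by rewrite indicE; congr (_%:R); congr nat_of_bool; apply/idP/idP; rewrite inE.
rewrite (indE (fun y => y.1 < sigma * y.2)) (indE (fun y => y.1 > sigma * y.2)).
rewrite /wedge /shock_line.
by case: ltgtP => _ /=; ring.
Qed.

End Limits.

Theorem theorem3p3 (R : realType) (ul ur rhol rhor : R)
    (hl : 0 < rhol) (hr : 0 < rhor) (hu : ur < ul) :
  (\forall eps \near (0 : R)^'+,
     exists! w : R * R, intermediate_state eps (ul, rhol) (ur, rhor) w) /\
  (forall w : R -> R * R,
     (\forall eps \near (0 : R)^'+,
        intermediate_state eps (ul, rhol) (ur, rhor) (w eps)) ->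
     distr_cvg0
       (fun eps => regular_distr
          (fun z => (two_shock eps (ul, rhol) (w eps) (ur, rhor) z).1))
       (regular_distr (limit_u ul ur)) /\
     distr_cvg0
       (fun eps => regular_distr
          (fun z => (two_shock eps (ul, rhol) (w eps) (ur, rhor) z).2))
       (limit_rho ul ur rhol rhor)).
Proof.
split; first exact: near0_intermediate_state.
move=> w hw.
pose s1 eps := shock_speed eps (w eps) (ul, rhol).
pose s2 eps := shock_speed eps (w eps) (ur, rhor).
pose sigma := (ul + ur) / 2.
have s12 : \forall eps \near (0 : R)^'+, s1 eps < s2 eps.
  exact: (near_speed_lt ul ur rhol rhor w hl hr hw).
have s1s : s1 eps @[eps --> 0^'+] --> sigma.
  exact: (cvg_speed1 ul ur rhol rhor w hl hr hu hw).
have s2s : s2 eps @[eps --> 0^'+] --> sigma.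
  exact: (cvg_speed2 ul ur rhol rhor w hl hr hu hw).
have us : (w eps).1 @[eps --> 0^'+] --> sigma.
  exact: (cvg_intermediate_velocity ul ur rhol rhor w hl hr hu hw).
have mass : (w eps).2 * (s2 eps - s1 eps) @[eps --> 0^'+] -->
    (ul - ur) * ((rhol + rhor) / 2).
  exact: (cvg_concentrated_mass ul ur rhol rhor w hl hr hu hw).
have ul_u : ul - (w eps).1 @[eps --> 0^'+] --> ul - sigma.
  by apply: cvgB => //; exact: cvg_cst.
have u_ur : (w eps).1 - ur @[eps --> 0^'+] --> sigma - ur.
  by apply: cvgB => //; exact: cvg_cst.
have J (s : R -> R) (phi : R * R -> R) :
    test_function phi -> s eps @[eps --> 0^'+] --> sigma ->
    left_pairing phi (s eps) @[eps --> 0^'+] --> left_pairing phi sigma.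
  move=> tphi ss; apply: (cvg_left_pairing phi sigma s) => //.
    exact: continuous_test_function.
  exact: test_function_bounded_supported.
split=> phi tphi; have cphi := continuous_test_function phi tphi;
  have bphi := test_function_bounded_supported phi tphi;
  have := J s1 phi tphi s1s; have := J s2 phi tphi s2s => J2 J1.
- rewrite (jump_integral phi _ sigma ul ur _ bphi (limit_u_wedge ul ur)).
  set Joo := Rintegral _ _ _.
  have -> : (ul - ur) * left_pairing phi sigma + ur * Joo =
    (ul - sigma) * left_pairing phi sigma
    + (sigma - ur) * left_pairing phi sigma + ur * Joo by ring.
  have : (ul - (w eps).1) * left_pairing phi (s1 eps)
      + ((w eps).1 - ur) * left_pairing phi (s2 eps) + ur * Joo
      @[eps --> 0^'+] -->
    (ul - sigma) * left_pairing phi sigma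
      + (sigma - ur) * left_pairing phi sigma + ur * Joo.
    apply: cvgD; last exact: cvg_cst.
    by apply: cvgD; apply: cvgM.
  apply: cvg_trans; apply: near_eq_cvg; near=> eps.
  rewrite -step_integral//; last by apply: ltW; near: eps.
  congr (regular_distr _ _); apply/funext => z.
  by rewrite /two_shock /s1 /s2; case: ifP => // _; case: ifP.
- rewrite /limit_rho (jump_integral phi _ sigma rhol rhor _ bphi
    (limit_rho_wedge sigma rhol rhor)) line_delta_linear//.
  set Joo := Rintegral (_ \x _)%E _ _; set B := Rintegral _ _ _.
  have -> : (rhol - rhor) * left_pairing phi sigma + rhor * Joo
      + (ul - ur) * ((rhol + rhor) / 2) * B =
    (rhol * left_pairing phi sigma - rhor * left_pairing phi sigma)
    + rhor * Joo + (ul - ur) * ((rhol + rhor) / 2) * B by ring.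
  have : (rhol * left_pairing phi (s1 eps) - rhor * left_pairing phi (s2 eps))
      + rhor * Joo
      + (w eps).2 * (left_pairing phi (s2 eps) - left_pairing phi (s1 eps))
      @[eps --> 0^'+] -->
    (rhol * left_pairing phi sigma - rhor * left_pairing phi sigma)
    + rhor * Joo + (ul - ur) * ((rhol + rhor) / 2) * B.
    apply: cvgD; last exact: cvg_mass_left_pairing.
    apply: cvgD; last exact: cvg_cst.
    by apply: cvgB; apply: cvgM => //; exact: cvg_cst.
  apply: cvg_trans; apply: near_eq_cvg; near=> eps.
  transitivity ((rhol - (w eps).2) * left_pairing phi (s1 eps)
    + ((w eps).2 - rhor) * left_pairing phi (s2 eps) + rhor * Joo); first by ring.
  rewrite -step_integral//; last by apply: ltW; near: eps.
  congr (regular_distr _ _); apply/funext => z.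
  by rewrite /two_shock /s1 /s2; case: ifP => // _; case: ifP.
Unshelve. all: by end_near. Qed.
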